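(* Let $k\ge2$, $0\le\alpha<1$, and let $\pi$ be a non-increasing degree sequence of some $k$-uniform supertrees. Then $G_\pi$ is the unique (up to isomorphism) $k$-uniform supertree with maximum $\alpha$-spectral radius in $\mathbb{T}_\pi$.
   Context: A $k$-uniform hypergraph has edges that are $k$-element vertex subsets; $d_G(v)$ is the number of edges containing $v$. A supertree is a connected acyclic hypergraph. $\mathbb{T}_\pi$ is the set of all $k$-uniform supertrees with degree sequence $\pi$. For a supertree $G$ with a chosen root $v_0$, the height $h(v)$ of a vertex is its distance to $v_0$. A well-ordering $\prec$ of $V(G)$ is a BFS-ordering if: (i) $u\prec v$ implies $h(u)\le h(v)$; (ii) $u\prec v$ implies $d_G(u)\ge d_G(v)$; (iii) for $\{u,u'\}\subset e\in E(G)$ and $\{v,v'\}\subset f\in E(G)$ with $h(u)=h(u')+1$ and $h(v)=h(v')+1$, if $u\prec v$ then $u'\prec v'$; (iv) for every edge $e=\{v_1,\dots,v_k\}$ with $v_1\prec\dots\prec v_k$, there is no vertex $u\notin e$ with $v_i\prec u\prec v_{i+1}$ for any $2\le i\le k-1$. A BFS-supertree is a $k$-uniform supertree admitting, for some root, a BFS-ordering. It is known that $\mathbb{T}_\pi$ contains a BFS-supertree and that any two BFS-supertrees with the same degree sequence are isomorphic; $G_\pi$ denotes this BFS-supertree in $\mathbb{T}_\pi$. The $\alpha$-spectral radius $\rho_\alpha(G)$ is the spectral radius of $\mathcal{A}_\alpha(G)=\alpha\mathcal{D}(G)+(1-\alpha)\mathcal{A}(G)$, where $\mathcal{D}(G)$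 is the diagonal degree tensor and $\mathcal{A}(G)$ is the order-$k$ adjacency tensor with entry $1/(k-1)!$ at $(i_1,\dots,i_k)$ when $\{v_{i_1},\dots,v_{i_k}\}\in E(G)$ and $0$ otherwise; $\lambda$ is an eigenvalue of order-$k$ tensor $\mathcal{T}$ if $\mathcal{T}x^{k-1}=\lambda x^{[k-1]}$ for some $x\ne0$. *)

(* Defs.v *)
From HB Require Import structures.
From mathcomp Require Export all_boot all_order all_algebra.
From mathcomp Require Export classical_sets wochoice reals.
From mathcomp Require Export complex.

Set Implicit Arguments.
Unset Strict Implicit.
Unset Printing Implicit Defensive.

Import Order.TTheory GRing.Theory Num.Theory.

Record hypergraph := Hypergraph {
  vertex :> finType;
  edges : {set {set vertex}}
}.

Definition uniform (k : nat) (G : hypergraph) : Prop :=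
  forall e : {set G}, e \in edges G -> #|e| = k.

Definition degree (G : hypergraph) (v : G) : nat :=
  #|[pred e in edges G | v \in e]|.

Definition adjacent (G : hypergraph) : rel G :=
  fun u v => (u != v) && [exists e in edges G, (u \in e) && (v \in e)].

Definition connected (G : hypergraph) : Prop :=
  0 < #|G| /\ forall u v : G, connect (@adjacent G) u v.

(* Cycle of length l >= 2 in the sense of Berge:
   v_0, e_0, v_1, e_1, ..., v_(l-1), e_(l-1), v_0 with pairwise distinct v_i,
   pairwise distinct e_i and {v_i, v_(i+1 mod l)} included in e_i. *)
Definition has_cycle (G : hypergraph) : Prop :=
  exists (l : nat) (v : 'I_l -> G) (e : 'I_l -> {set G}),
    [/\ 2 <= l, injective v, injective e &
        forall i, [/\ e i \in edges G, v i \in e i & v (ordS i) \in e i]].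

Definition supertree (k : nat) (G : hypergraph) : Prop :=
  [/\ uniform k G, connected G & ~ has_cycle G].

Definition has_degree_sequence (pi : seq nat) (G : hypergraph) : Prop :=
  perm_eq [seq degree v | v <- enum G] pi.

Definition in_TT (k : nat) (pi : seq nat) (G : hypergraph) : Prop :=
  supertree k G /\ has_degree_sequence pi G.

Definition isomorphic (G H : hypergraph) : Prop :=
  exists f : G -> H,
    bijective f /\ forall e : {set G}, (f @: e \in edges H) = (e \in edges G).

Definition walk_of_length (G : hypergraph) (u v : G) (n : nat) : bool :=
  [exists p : n.-tuple G, path (@adjacent G) u p && (last u p == v)].

(* A shortest walk has length < #|G|; the junk value #|G| is returned when
   there is no walk from u to v. *)
Definition distance (G : hypergraph) (u v : G) : nat :=
  find (walk_of_length u v) (iota 0 #|G|).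

(* [le] is the reflexive form of the ordering, as in [well_order]. In (iii) this
   is essential: distinct u and v may have the same parent u' = v'.
   In (iv), s_0, s_1, ... are the vertices of e in increasing order, counted
   from 0, hence the shift of the bounds on i. *)
Definition BFS_ordering (G : hypergraph) (v0 : G) (le : rel G) : Prop :=
  let h := distance v0 in
  well_order le /\
  [/\ (* i *) forall u v : G, le u v -> h u <= h v,
      (* ii *) forall u v : G, le u v -> degree v <= degree u,
      (* iii *) forall (e f : {set G}) (u u' v v' : G),
        e \in edges G -> f \in edges G ->
        u \in e -> u' \in e -> v \in f -> v' \in f ->
        h u = (h u').+1 -> h v = (h v').+1 ->
        le u v -> le u' v'
    & (* iv *) forall e : {set G}, e \in edges G ->
        let s := sort le (enum e) in
        forall (i : nat) (u : G), 1 <= i -> i.+1 < #|e| -> u \notin e ->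
        ~ (le (nth u s i) u /\ le u (nth u s i.+1))].

Definition BFS_supertree (k : nat) (G : hypergraph) : Prop :=
  supertree k G /\ exists (v0 : G) (le : rel G), BFS_ordering v0 le.

Local Open Scope ring_scope.
Local Open Scope complex_scope.

Definition tensor (R : realType) (V : finType) (k : nat) := k.-tuple V -> R.

(* The component of T x^(k-1) at i is the sum over i_2, ..., i_k of
   T(i, i_2, ..., i_k) x(i_2) ... x(i_k). *)
Definition tensor_apply (R : realType) (V : finType) (k : nat)
    (T : tensor R V k) (x : {ffun V -> R[i]}) (i : V) : R[i] :=
  \sum_(t : k.-tuple V | ohead t == Some i) (T t)%:C * \prod_(j <- behead t) x j.

Definition tensor_eigenvalue (R : realType) (V : finType) (k : nat)
    (T : tensor R V k) (lambda : R[i]) : Prop :=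
  exists x : {ffun V -> R[i]},
    x != 0 /\ forall i, tensor_apply T x i = lambda * x i ^+ k.-1.

Definition spectral_radius (R : realType) (V : finType) (k : nat)
    (T : tensor R V k) : R :=
  sup [set Normc.normc lambda | lambda in tensor_eigenvalue T]%classic.

Definition degree_tensor (R : realType) (k : nat) (G : hypergraph) :
    tensor R G k :=
  fun t => if ohead t is Some v then
             if all (pred1 v) t then (degree v)%:R else 0
           else 0.

Definition adjacency_tensor (R : realType) (k : nat) (G : hypergraph) :
    tensor R G k :=
  fun t => if [set v in t] \in edges G then (((k.-1)`!)%:R)^-1 else 0.

Definition alpha_tensor (R : realType) (k : nat) (alpha : R) (G : hypergraph) :
    tensor R G k :=
  fun t => alpha * degree_tensor R t + (1 - alpha) * adjacency_tensor R t.

Definition alpha_spectral_radius (R : realType) (k : nat) (alpha : R)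
    (G : hypergraph) : R :=
  spectral_radius (alpha_tensor (k := k) alpha (G := G)).

(* Main.v *)
(** Let [rho] be the spectral radius. By compactness and connectedness the form
    [F x = sum_i x_i (A_alpha x^(k-1))_i] has a positive maximizer [x] on the
    sphere [sum_i x_i^k = 1]; it is an eigenvector for [rho], and [rho] bounds
    the modulus of every eigenvalue.

    Root a supertree [H] at a vertex of largest weight. Since each other vertex
    has one edge above it, [F x] depends only on the list of pairs (weight of the
    top vertex, weights of the other vertices) over the edges. Transporting the
    weights of [H], in decreasing order, to the BFS-ordered vertices of [G] makes
    the sorted list of top weights larger and groups the other weights
    consecutively; both operations increase the sum of the products over the
    edges. Hence [rho H <= rho G].

    In case of equality the transported weights form an eigenvector of [G] and
    the multisets of weighted edges of [G] and [H] agree. In [G], comparing the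
    eigenvalue equations of two vertices of equal weight along the BFS-ordering
    shows that they are incident to the same weighted edges; the eigenvalue
    equations of [H] carry this over to [H]. Two trees whose vertices see the same
    weighted edges are isomorphic, by extending an isomorphism edge by edge. *)
From mathcomp Require Import boolp topology normedtype derive realfun.
Require Import Defs.
From mathcomp Require Import all_boot all_order all_algebra.
From mathcomp Require Import reals ring lra zify.
Import numFieldNormedType.Exports.

Set Implicit Arguments.
Unset Strict Implicit.
Unset Printing Implicit Defensive.

Import Order.TTheory GRing.Theory Num.Theory.

(** * Berge acyclicity and rooted supertrees *)

(** The edges of the two trees have no natural correspondence, so they are compared as sorted lists.
    Rooting at a heaviest vertex makes this possible: a vertex is the top of all its edges but the
    one above it, so the number of edges whose top weighs at least [c] is the degree sum over the
    vertices of weight at least [c], minus the number of those other than the root. The subtracted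
    number is the same in [G] and [H], as both roots carry the largest weight, and the degree sum is
    largest in [G], where weights and degrees decrease together. Hence the top weights of [G]
    dominate termwise. The diagonal part of the form is a sum of powers of these top weights, up to
    a common constant.

    The equality case must cope with ties: distinct vertices may have the same weight, so equal
    multisets of weighted edges do not yet tell how the edges are glued. What is needed is that the
    weight of a vertex determines how many edges of each type it has. For [H] only the sums of these
    numbers over a whole weight class are known at first, and the eigenvalue equation is used to
    separate the vertices of a class. *)

Section Hypergraph.
Variable G : hypergraph.
Implicit Types (u v w : G) (e f : {set G}) (S : {set G}) (W : {set {set G}}).

(* A Berge walk is a sequence of pairs (edge, vertex): each vertex is reached
   through the edge of its pair. *)
Definition berge_step W : rel ({set G} * G) :=
  fun a b => [&& b.1 \in W, a.2 \in b.1 & b.2 \in b.1].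

Lemma has_cycle_of_seq (c : seq ({set G} * G)) :
  1 < size c -> uniq (map fst c) -> uniq (map snd c) ->
  cycle (berge_step (edges G)) c -> has_cycle G.
Proof.
move=> c1 u1 u2 cc; have x0 : {set G} * G by case: (c) c1.
(* Each pair holds the edge leading to its vertex, so the edge from the [i]-th vertex to the next
   belongs to the next pair: hence [ordS]. *)
exists (size c), (fun i => (nth x0 c i).2), (fun i => (nth x0 c (ordS i)).1).
have sn (i j : 'I_(size c)) : (nth x0 c i).2 = (nth x0 c j).2 -> i = j.
  move=> /eqP; rewrite -!(nth_map x0 x0.2) // nth_uniq ?size_map //.
  by move/eqP/val_inj.
have fn (i j : 'I_(size c)) : (nth x0 c i).1 = (nth x0 c j).1 -> i = j.
  move=> /eqP; rewrite -!(nth_map x0 x0.1) // nth_uniq ?size_map //.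
  by move/eqP/val_inj.
split=> //; first by move=> i j /fn/ordS_inj.
move=> i; have : berge_step (edges G) (nth x0 c i) (nth x0 c (ordS i)).
  case: c c1 {u1 u2 sn fn} cc i => [//|a c] _ /(pathP x0) cc [i /= ilt].
  have := cc i; rewrite size_rcons => /(_ ilt).
  case: (ltnP i (size c)) => ic.
    rewrite modn_small // nth_rcons ic.
    by case: i ilt ic => //= i _ ic; rewrite nth_rcons (ltn_trans (ltnSn i) ic).
  have -> : i = size c by apply/eqP; rewrite eqn_leq ic andbT -ltnS.
  rewrite modnn /= nth_rcons ltnn eqxx.
  by rewrite -rcons_cons nth_rcons /= ltnSn.
by case/and3P.
Qed.

(** Induction principle for trees: edges are glued one at a time. That a new edge meets [S] only in
    [w] is not imposed; it follows from acyclicity in [grown_meet]. *)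
Inductive grown v0 : {set G} -> {set {set G}} -> Prop :=
| Grown0 : grown v0 [set v0] set0
| GrownS S W e w : grown v0 S W -> e \in edges G -> e \notin W ->
    w \in S -> w \in e -> grown v0 (S :|: e) (e |: W).

Lemma grown_root v0 S W : grown v0 S W -> v0 \in S.
Proof. by elim=> [|{}S {}W e w _ v0S _ _ _ _]; rewrite !inE ?eqxx ?v0S. Qed.

Lemma grown_edges v0 S W : grown v0 S W -> W \subset edges G.
Proof.
elim=> [|{}S {}W e w _ WG eG _ _ _]; first exact: sub0set.
by rewrite subUset sub1set eG.
Qed.

Lemma grown_sub v0 S W : grown v0 S W -> {in W, forall e, e \subset S}.
Proof.
elim=> [|{}S {}W e w _ WS eG _ _ _] f; rewrite !inE // => /orP[/eqP->|/WS fS].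
  exact: subsetUr.
exact: subset_trans fS (subsetUl _ _).
Qed.

(** A path into the new edge is routed through [w], and [e] is fresh, so the edges stay distinct.
    The edge [e0] only completes the initial pair; [berge_step] does not look at it. *)
Lemma grown_walk v0 S W e0 : grown v0 S W ->
  {in S &, forall u v, exists p,
    [/\ path (berge_step W) (e0, u) p, uniq (u :: map snd p),
        uniq (map fst p), last (e0, u).2 (map snd p) = v &
        all (mem S) (u :: map snd p)]}.
Proof.
elim=> [|{}S {}W e w gr IH eG eW wS we] u v.
  by rewrite !inE => /eqP-> /eqP->; exists [::]; rewrite /= inE eqxx.
have sS : {subset S <= S :|: e} by move=> z zS; rewrite inE zS.
have WW : subrel (berge_step W) (berge_step (e |: W)).
  by move=> a b /and3P[h1 h2 h3]; rewrite /berge_step !inE h1 orbT h2.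
have allS s : all (mem S) s -> all (mem (S :|: e)) s.
  by move=> /allP sSs; apply/allP => z /sSs; apply: sS.
have notW a p : path (berge_step W) a p -> e \notin map fst p.
  elim: p a => //= b p IHp a /andP[/and3P[bW _ _] /IHp].
  rewrite inE negb_or => ->; rewrite andbT.
  by apply: contra eW => /eqP->.
case: (boolP (u \in S)) => uS; case: (boolP (v \in S)) => vS.
- have [p [p1 p2 p3 p4 p5]] := IH _ _ uS vS.
  by exists p; split=> //; [exact: sub_path p1 | exact: allS].
- rewrite !inE (negPf vS) /= => _ ve; have [p [p1 p2 p3 p4 p5]] := IH _ _ uS wS.
  exists (rcons p (e, v)); rewrite rcons_path !map_rcons !last_rcons.
  rewrite (sub_path WW p1) !rcons_uniq !all_rcons p3 (notW _ _ p1) sS //=.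
  have /= /andP[_ ->] := allS _ p5; rewrite cons_uniq in p2; case/andP: p2 => up p2.
  rewrite mem_rcons inE negb_or up p2 (contraNneq _ vS) => [|<-//].
  rewrite (contra _ vS) => [|vp]; last by apply: (allP p5); rewrite inE vp orbT.
  rewrite inE ve orbT /berge_step setU11 /= ve andbT.
  by move: p4; rewrite (last_map snd p (e0, u)) => ->.
- rewrite !inE (negPf uS) /= => ue _; have [p [p1 p2 p3 p4 p5]] := IH _ _ wS vS.
  exists ((e, w) :: p) => /=; split=> //.
  + rewrite /berge_step setU11 /= ue we /=.
    by case: (p) p1 => //= b p' /andP[/WW h1 /(sub_path WW) ->]; rewrite andbT.
  + by move: p2 => /= ->; rewrite andbT; apply: contra uS => /(allP p5).
  + by rewrite (notW _ _ p1).
  + by apply/andP; split; [rewrite inE ue orbT | apply: allS p5].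
- rewrite !inE (negPf uS) (negPf vS) /= => ue ve.
  case: (eqVneq u v) => [<-|uv].
    by exists [::]; rewrite /= !inE ue orbT.
  exists [:: (e, v)]; split=> //=; last by rewrite !inE ue ve !orbT.
  + by rewrite /berge_step setU11 /= ue ve.
  + by rewrite inE uv.
Qed.

(** Two common vertices would be joined by a Berge path inside [W], which [e] closes to a cycle. *)
Lemma grown_meet v0 S W e : ~ has_cycle G -> grown v0 S W ->
  e \in edges G -> e \notin W -> {in S :&: e &, forall u v, u = v}.
Proof.
move=> acy gr eG eW u v; rewrite !inE => /andP[uS ue] /andP[vS ve].
apply/eqP/negP => /negP uv; apply: acy.
have [p [p1 p2 p3 p4 p5]] := grown_walk e gr uS vS.
have WE : subrel (berge_step W) (berge_step (edges G)).
  move=> a b /and3P[h1 h2 h3]; rewrite /berge_step h2 h3.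
  by rewrite (subsetP (grown_edges gr)).
apply: (@has_cycle_of_seq ((e, u) :: p)) => //=.
- by case: (p) p4 uv => //= ->; rewrite eqxx.
- rewrite p3 andbT; apply: contra eW.
  elim: (p) ((e, u)) p1 => //= b p' IHp a /andP[/and3P[bW _ _] /IHp].
  by rewrite inE => h /orP[/eqP->|].
- rewrite rcons_path (sub_path WE p1) /= /berge_step eG /= ue andbT.
  by move: p4; rewrite (last_map snd p (e, u)) => ->.
Qed.

(** While an edge is missing, one can be glued: if [S] is everything, any missing edge, nonempty
    since [k >= 2]; otherwise the edge by which a walk from [v0] leaves [S]. *)
Lemma grown_total k v0 : 2 <= k -> supertree k G -> grown v0 setT (edges G).
Proof.
move=> k2 [unif [_ conn] acy].
have step S W : grown v0 S W -> W != edges G ->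
    exists S' W', grown v0 S' W' /\ #|W| < #|W'|.
  move=> gr WE; have WG := grown_edges gr.
  have [e [w [eG eW wS we]]] : exists e w,
      [/\ e \in edges G, e \notin W, w \in S & w \in e].
    have [ST|] := boolP (S == setT).
      have /subsetPn[e eG eW] : ~~ (edges G \subset W).
        by apply: contra WE => EW; rewrite eqEsubset WG.
      have : 0 < #|e| by rewrite unif // (leq_trans _ k2).
      by case/card_gt0P => w we; exists e, w; rewrite (eqP ST) inE.
    rewrite eqEsubset subsetT /= => /subsetPn[v _ vS].
    have /connectP[p pp vl] := conn v0 v.
    have := grown_root gr; elim: p (v0) pp vl => /= [|b p IH] a.
      by move=> _ <- aS; rewrite aS in vS.
    case/andP=> ab pp vl aS; have [bS|bS] := boolP (b \in S); first exact: IH bS.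
    move: ab => /andP[_ /existsP[e /and3P[eG ae be]]].
    exists e, a; split=> //; apply: contra bS => /(grown_sub gr)/subsetP.
    exact.
  exists (S :|: e), (e |: W); split; first exact: GrownS gr eG eW wS we.
  by rewrite cardsU1 eW.
have [n] := ubnP (#|edges G| - #|@set0 {set G}|); have := Grown0 v0.
elim: n [set v0] (set0 : {set {set G}}) => // n IH S W gr le.
have WG := grown_edges gr; have [WE|/(step _ _ gr)[S' [W' [gr' lt]]]] := eqVneq W (edges G).
  suff -> : setT = S by rewrite -WE.
  apply/esym/eqP; rewrite eqEsubset subsetT /=; apply/subsetP => v _.
  have /connectP[p pp ->] := conn v0 v.
  have := grown_root gr; elim: p (v0) pp => //= b p IHp a /andP[ab pp] aS.
  move: ab => /andP[_ /existsP[e /and3P[]]]; rewrite -WE => eW ae be.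
  exact/IHp/(subsetP (grown_sub gr eW)).
apply: (IH S' W' gr'); have := subset_leq_card (grown_edges gr').
by move=> le'; rewrite (leq_trans _ (ltnSE le)) // ltn_sub2l // (leq_trans lt).
Qed.

(* A rooting assigns to each edge its top vertex [q e] and to each vertex but
   the root the edge [a v] above it; [h] is the resulting height. *)
Definition rooted v0 (q : {set G} -> G) (a : G -> {set G}) (h : G -> nat) :=
  [/\ {in edges G, forall e, q e \in e},
      forall v, v != v0 -> [/\ a v \in edges G, v \in a v & q (a v) != v],
      {in edges G, forall e, {in e, forall v, q e != v -> v != v0 /\ a v = e}},
      h v0 = 0 & forall v, v != v0 -> h v = (h (q (a v))).+1].

Lemma grown_rooted v0 S W : ~ has_cycle G -> grown v0 S W ->
  exists q a h,
  [/\ {in W, forall e, q e \in e},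
      {in S, forall v, v != v0 -> [/\ a v \in W, v \in a v & q (a v) != v]},
      {in W, forall e, {in e, forall v, q e != v -> v != v0 /\ a v = e}},
      h v0 = 0 & {in S, forall v, v != v0 -> h v = (h (q (a v))).+1}].
Proof.
move=> acy; elim=> [|{}S {}W e w gr [q [a [h [q1 a1 a2 h0 h1]]]] eG eW wS we].
  exists (fun=> v0), (fun=> set0), (fun=> 0).
  by split=> // [e|v|e|v]; rewrite !inE // => /eqP->; rewrite eqxx.
have v0S := grown_root gr.
have inS v : v \in S -> v \in e -> v = w.
  by move=> vS ve; apply: (grown_meet acy gr eG eW); rewrite inE ?vS ?wS.
have neW f : f \in W -> (f == e) = false.
  by move=> fW; apply: contraNF eW => /eqP<-.
exists (fun f => if f == e then w else q f),
  (fun v => if v \in S then a v else e),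
  (fun v => if v \in S then h v else (h w).+1).
have qS f : f \in W -> q f \in S.
  by move=> fW; apply: (subsetP (grown_sub gr fW)); apply: q1.
split.
- by move=> f; rewrite !inE; case: eqP => [->|_ /= /q1].
- move=> v; rewrite !inE; case: (boolP (v \in S)) => /= vS.
    move=> _ /(a1 v vS)[aW va qa].
    by rewrite neW // aW orbT.
  move=> ve _; rewrite eqxx; split=> //.
  by apply: contra vS => /eqP<-.
- move=> f; rewrite !inE; case: eqP => [-> _|_ /= fW] v vf.
    case: (boolP (v \in S)) => vS; first by rewrite (inS _ vS vf) eqxx.
    by split=> //; apply: contra vS => /eqP->.
  by rewrite (subsetP (grown_sub gr fW) _ vf); apply: a2.
- by rewrite v0S.
- move=> v; rewrite !inE; case: (boolP (v \in S)) => /= vS _ vv0.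
    by have [aW _ _] := a1 v vS vv0; rewrite neW // qS // h1.
  by rewrite eqxx wS.
Qed.

Lemma supertree_rooted k v0 : 2 <= k -> supertree k G ->
  exists q a h, rooted v0 q a h.
Proof.
move=> k2 sG; have [_ _ acy] := sG.
have [q [a [h [q1 a1 a2 h0 h1]]]] := grown_rooted acy (grown_total v0 k2 sG).
by exists q, a, h; split=> // v vv0; [apply: a1 | apply: h1].
Qed.

(** * Consequences of a rooting: distances, connectedness, acyclicity *)

Section Rooted.
Variables (v0 : G) (q : {set G} -> G) (a : G -> {set G}) (h : G -> nat).
Hypothesis rG : rooted v0 q a h.

Lemma rooted_child e v : e \in edges G -> v \in e -> q e != v ->
  h v = (h (q e)).+1.
Proof.
by case: rG => _ _ a2 _ h1 eG ve qv; have [v0v <-] := a2 _ eG _ ve qv; apply: h1.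
Qed.

Lemma rooted_walk v : exists2 p : seq G,
  path (@adjacent G) v0 p & last v0 p = v /\ size p = h v.
Proof.
case: (rG) => q1 a1 _ h0 h1.
have [n] := ubnP (h v); elim: n v => // n IH v le.
have [->|vv0] := eqVneq v v0; first by exists [::]; rewrite //= h0.
have [aG va qa] := a1 v vv0; have hv := h1 v vv0.
have [|p pp [pl ps]] := IH (q (a v)); first by rewrite -ltnS -hv.
exists (rcons p v); last by rewrite last_rcons size_rcons ps hv.
rewrite rcons_path pp pl /adjacent qa; apply/existsP; exists (a v).
by rewrite aG q1.
Qed.

Lemma rooted_adjacent u v : adjacent u v -> h v <= (h u).+1.
Proof.
case/andP=> uv /existsP[e /and3P[eG ue ve]].
case: (eqVneq (q e) u) => [qu|qu]; case: (eqVneq (q e) v) => [qv|qv].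
- by rewrite -qv qu leqnSn.
- by rewrite (rooted_child eG ve qv) qu.
- by rewrite (rooted_child eG ue qu) qv ltnW // ltnS leqnSn.
- by rewrite (rooted_child eG ve qv) (rooted_child eG ue qu).
Qed.

(** The ancestors of [v] realise all heights from 0 to [h v]. The bound is needed because [distance]
    only searches lengths below [#|G|]. *)
Lemma rooted_height_max v : h v < #|G|.
Proof.
have im n : n <= h v -> n \in map h (enum G).
  case: (rG) => _ _ _ h0 h1.
  have [m] := ubnP (h v); elim: m v => // m IH v le; rewrite leq_eqVlt.
  case/orP=> [/eqP->|]; first by apply: map_f; rewrite mem_enum.
  have [->|vv0] := eqVneq v v0; first by rewrite h0.
  by move: (le); rewrite (h1 v vv0) !ltnS; apply: IH.
rewrite -(size_iota 0 (h v).+1) cardE -(size_map h (enum G)).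
apply: uniq_leq_size; first exact: iota_uniq.
by move=> n; rewrite mem_iota ltnS => /im.
Qed.

Lemma rooted_distance v : distance v0 v = h v.
Proof.
have [p pp [pl ps]] := rooted_walk v.
have lt := rooted_height_max v.
have hw : walk_of_length v0 v (nth 0 (iota 0 #|G|) (h v)).
  rewrite nth_iota //; apply/existsP; rewrite add0n -ps.
  by exists (in_tuple p); rewrite pp pl eqxx.
have le : has (walk_of_length v0 v) (iota 0 #|G|).
  by apply/hasP; exists (h v) => //; [rewrite mem_iota | move: hw; rewrite nth_iota].
apply/eqP; rewrite eqn_leq; apply/andP; split.
  by rewrite leqNgt; apply/negP => /(before_find 0); rewrite hw.
have := nth_find 0 le; rewrite nth_iota ?add0n; last first.
  by move: le; rewrite has_find size_iota.
rewrite -/(distance v0 v); case/existsP=> t /andP[tp /eqP tl].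
rewrite -[X in _ <= X](size_tuple t) -[in X in X <= _]tl; move: (tval t) tp => {tl}t tp.
case: (rG) => _ _ _ h0 _; rewrite -[X in _ <= X]addn0 -h0.
elim: t (v0) tp => //= b s IH c /andP[/rooted_adjacent bc /IH le'].
by rewrite addSnnS (leq_trans le') // leq_add2l.
Qed.

Lemma rooted_connected : connected G.
Proof.
have sym : connect_sym (@adjacent G).
  apply: sym_connect_sym => u v; rewrite /adjacent eq_sym; congr andb.
  by apply: eq_existsb => e; rewrite [(u \in e) && _]andbC.
split; first exact: (leq_ltn_trans (leq0n _) (rooted_height_max v0)).
have c0 v : connect (@adjacent G) v0 v.
  by have [p pp [pl _]] := rooted_walk v; apply/connectP; exists p.
by move=> u v; rewrite (connect_trans _ (c0 v)) // sym.
Qed.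

(** At a cycle vertex of largest height, neither incident cycle edge has it as top, since its other
    vertices would then be higher; so both are the edge above it, against distinctness. *)
Lemma rooted_acyclic : ~ has_cycle G.
Proof.
case=> l [v [e [l2 vi ei ve]]]; case: (rG) => q1 a1 a2 h0 h1.
have i0 : 'I_l by exact: Ordinal l2.
have [i _ imax] := @arg_maxnP _ i0 xpredT (fun i => h (v i)) isT.
have nS (j : 'I_l) : ordS j != j.
  apply/eqP => /(congr1 val) /=; case: (ltnP j.+1 l) => [lt|le].
    by rewrite modn_small // => /eqP; rewrite -[X in _ == X]addn0 -addn1 eqn_add2l.
  have -> : j.+1 = l by apply/eqP; rewrite eqn_leq le ltn_ord.
  by rewrite modnn => j0; move: le l2; rewrite -j0; case: (l) => [|[]].
set j := ord_pred i; have ij : i = ordS j by rewrite /j ord_predK.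
have child f (w : 'I_l) : f \in edges G -> v i \in f -> v w \in f -> v w != v i ->
    v i != v0 /\ a (v i) = f.
  move=> fG vf wf wi; apply: a2 => //; apply/eqP => qi.
  have := rooted_child fG wf; rewrite qi eq_sym => /(_ wi) hw.
  by have := imax w isT; rewrite /= hw ltnn.
have [eiG vei vSei] := ve i; have [ejG vej] := ve j; rewrite -ij => vSej.
have [_ ai] : v i != v0 /\ a (v i) = e i.
  by apply: (child _ (ordS i)); rewrite // (inj_eq vi) nS.
have [_ aj] : v i != v0 /\ a (v i) = e j.
  by apply: (child _ j); rewrite // (inj_eq vi) eq_sym [X in X != _]ij nS.
by move: (nS j); rewrite -ij -(inj_eq ei) -ai aj eqxx.
Qed.

End Rooted.
End Hypergraph.

Local Open Scope ring_scope.


(** * The Perron vector *)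

Lemma exists_root (R : rcfType) (k : nat) (a : R) : (0 < k)%N -> 0 < a ->
  exists2 c, 0 < c & c ^+ k = a.
Proof.
move=> k0 a0; have [||c /andP[c0 _]] := @poly_ivt R ('X^k - a%:P) 0 (1 + a).
- by rewrite addr_ge0 // ltW.
- rewrite !hornerE expr0n eqn0Ngt k0 sub0r oppr_le0 ltW //= subr_ge0.
  by rewrite (le_trans _ (ler_eXnr k0 _)) ?lerDr ?lerDl ?ltW.
rewrite /root !hornerE subr_eq0 => /eqP ck; exists c => //.
rewrite lt_def c0 andbT; apply: contraTneq a0 => c00.
by rewrite -ck c00 expr0n eqn0Ngt k0 ltxx.
Qed.

Section Form.
Variables (R : realType) (k : nat) (alpha : R) (G : hypergraph).
Implicit Types (x y : G -> R) (e : {set G}).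

Definition edge_weight x e : R := \prod_(v in e) x v.

Definition form x : R :=
  alpha * (\sum_v (degree v)%:R * x v ^+ k) +
  (1 - alpha) * (k%:R * \sum_(e in edges G) edge_weight x e).

Definition knorm x : R := \sum_v x v ^+ k.

Lemma form_homog (c : R) x : uniform k G ->
  form (fun v => c * x v) = c ^+ k * form x.
Proof.
move=> unif; rewrite /form mulrDr; congr (_ + _).
  rewrite mulrCA; congr (_ * _); rewrite big_distrr /=; apply: eq_bigr => v _.
  by rewrite exprMn mulrCA.
rewrite [RHS]mulrCA; congr (_ * _); rewrite [RHS]mulrCA; congr (_ * _).
rewrite big_distrr /=; apply: eq_bigr => e /unif ek.
by rewrite /edge_weight big_split /= prodr_const ek.
Qed.

Lemma knorm_homog (c : R) x : knorm (fun v => c * x v) = c ^+ k * knorm x.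
Proof. by rewrite /knorm big_distrr /=; apply: eq_bigr => v _; rewrite exprMn. Qed.

Section Continuity.
Variable T : topologicalType.
Variable X : T -> G -> R.
Hypothesis X_cont : forall v, continuous (fun t => X t v).

Let addc : continuous (fun z : R * R => z.1 + z.2) := @add_continuous R.
Let mulc : continuous (fun z : R * R => z.1 * z.2) := @mul_continuous R.

Lemma continuous_pow v : continuous (fun t => X t v ^+ k).
Proof.
move=> t; apply: (@continuous_comp _ _ _ (fun t => X t v) (fun z => z ^+ k)).
  exact: X_cont.
exact: exprn_continuous.
Qed.

Lemma continuous_knorm : continuous (fun t => knorm (X t)).
Proof. by apply: continuous_big => // v _; apply: continuous_pow. Qed.

(** Stated along a family [X] of weightings, because the compactness argument runs over row vectors
    while [form] takes functions on the vertices. *)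
Lemma continuous_form : continuous (fun t => form (X t)).
Proof.
have cst (c : R) : continuous (fun _ : T => c) by exact: cst_continuous.
have deg : continuous (fun t => \sum_v (degree v)%:R * X t v ^+ k).
  apply: continuous_big => // v _ t.
  apply: (@continuousM _ _ (fun=> (degree v)%:R) (fun t => X t v ^+ k)).
    exact: cst.
  exact: continuous_pow.
have edg : continuous (fun t => \sum_(e in edges G) edge_weight (X t) e).
  by apply: continuous_big => // e _; apply: continuous_big => // v _.
move=> t; apply: (@continuousD _ _ _ (fun t => alpha * _) (fun t => (1 - alpha) * _)).
  apply: (@continuousM _ _ (fun=> alpha) (fun t => \sum_v _)); first exact: cst.
  exact: deg.
apply: (@continuousM _ _ (fun=> 1 - alpha) (fun t => k%:R * _)); first exact: cst.
apply: (@continuousM _ _ (fun=> k%:R) (fun t => \sum_(e in _) _)); first exact: cst.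
exact: edg.
Qed.

End Continuity.

Lemma le_edge_weight x y e : (forall v, 0 <= x v <= y v) ->
  edge_weight x e <= edge_weight y e.
Proof. by move=> xy; apply: ler_prod. Qed.

Lemma form_maximizer : uniform k G -> (0 < #|G|)%N -> (0 < k)%N ->
  exists x, [/\ forall v, 0 <= x v, knorm x = 1 &
    forall y, (forall v, 0 <= y v) -> form y <= form x * knorm y].
Proof.
move=> unif G0 k0; pose n := #|G|.
pose X (M : 'rV[R]_n) (v : G) := M ord0 (enum_rank v).
have Xc v : continuous (fun M => X M v) by exact: coord_continuous.
(* The upper bound 1 follows from [knorm = 1]; it displays [A] as a closed subset of a cube. *)
pose A : classical_sets.set 'rV[R]_n :=
  fun M => (forall i, 0 <= M ord0 i <= 1) /\ knorm (X M) = 1.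
have XK x : X (\row_i x (enum_val i)) = x.
  by apply: funext => v; rewrite /X mxE enum_rankK.
have cA : compact A.
  apply: (@subclosed_compact _ _
    (fun M : 'rV[R]_n => forall i, `[0, 1]%classic (M ord0 i))); last first.
  - by move=> M [M01 _] i; rewrite /= in_itv /=.
  - exact: (@rV_compact R n (fun=> `[0, 1]%classic) (fun=> @segment_compact R 0 1)).
  - rewrite (_ : A = ((\bigcap_(i in @classical_sets.setT 'I_n)
         ((fun M : 'rV[R]_n => M ord0 i) @^-1` `[0,1]))
       `&` ((fun M => knorm (X M)) @^-1` (fun r => r = 1)))%classic).
      apply: closedI; last first.
        apply: preimage_closed; last exact: closed_eq.
        by move=> M _; apply: continuous_knorm.
      apply: closed_bigI => i _; apply: preimage_closed; last exact: itv_closed.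
      by move=> M _; apply: coord_continuous.
    rewrite classical_sets.eqEsubset; split=> M [M1 M2]; split=> // i.
      by move=> _; rewrite /= in_itv /= M1.
    by have := M1 i I; rewrite /= in_itv.
have XA y : (forall v, 0 <= y v) -> knorm y = 1 -> A (\row_i y (enum_val i)).
  move=> y0 yk; split; last by rewrite XK.
  move=> i; rewrite mxE y0 /=; rewrite -(@expr_le1 _ k) ?y0 // -yk.
  rewrite /knorm (bigD1 (enum_val i)) //= ler_wpDr // sumr_ge0 // => v _.
  exact: exprn_ge0.
have A0 : classical_sets.nonempty A.
  have /card_gt0P[v0 _] := G0.
  exists (\row_i (fun v => (v == v0)%:R) (enum_val i)).
  apply: (XA (fun v => (v == v0)%:R)) => [v|].
    exact: ler0n.
  rewrite /knorm (bigD1 v0) //= eqxx expr1n big1 ?addr0 // => v /negPf->.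
  by rewrite expr0n eqn0Ngt k0.
have [|M MA Mmax] := EVT_max_rV A0 cA (f := fun M => form (X M)).
  by apply: continuous_subspaceT; apply: continuous_form.
move: MA; rewrite classical_sets.in_setE => -[M01 Mk].
exists (X M); split=> //; first by move=> v; case/andP: (M01 (enum_rank v)).
move=> y y0; have yk0 v : 0 <= y v ^+ k by exact: exprn_ge0.
have [y1|y1] := eqVneq (knorm y) 0.
  have yE v : y v = 0.
    move/eqP: y1; rewrite psumr_eq0 // => /allP/(_ v (mem_index_enum _)) /=.
    by rewrite expf_eq0 k0 => /eqP.
  rewrite y1 mulr0.
  have -> : y = (fun v => 0 * y v) by apply: funext => v; rewrite yE mulr0.
  by rewrite form_homog // expr0n eqn0Ngt k0 mul0r.
have n0 : 0 < knorm y by rewrite lt_def y1 sumr_ge0.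
have [c c0 ck] := exists_root k0 n0.
have yE : y = (fun v => c * (c^-1 * y v)).
  by apply: funext => v; rewrite mulrA divff ?mul1r // gt_eqF.
rewrite {1}yE form_homog // ck [leRHS]mulrC ler_pM2l //.
have := Mmax (\row_i (c^-1 * y (enum_val i))).
rewrite (XK (fun v => c^-1 * y v)); apply; rewrite classical_sets.in_setE.
apply: (XA (fun v => c^-1 * y v)).
  by move=> v; rewrite mulr_ge0 // invr_ge0 ltW.
by rewrite knorm_homog exprVn ck mulVf.
Qed.
End Form.

(** * The tensor action as a sum over incident edges *)

Section TensorApply.
Local Open Scope complex_scope.
Variables (R : realType) (k : nat) (G : hypergraph).

Lemma cons_tupleE (e : {set G}) (i : G) (s : k.-tuple G) : #|e| = k.+1 ->
  ([set v in i :: s] == e) = [&& i \in e, all (mem (e :\ i)) s & uniq s].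
Proof.
move=> ek; apply/eqP/and3P => [se|[ie sE us]].
  have : uniq (i :: s).
    apply/card_uniqP; rewrite /= size_tuple -ek -se.
    by apply: eq_card => v; rewrite inE.
  case/andP=> is_ us; split; rewrite // -?se ?inE ?eqxx //.
  apply/allP => v vs; rewrite /= !inE vs orbT andbT.
  by apply: contraNneq is_ => <-.
have is_ : i \notin s by apply/negP => /(allP sE); rewrite /= !inE eqxx.
apply/eqP; rewrite eqEcard ek; apply/andP; split.
  by apply/subsetP => v; rewrite !inE => /orP[/eqP->//|/(allP sE)]; rewrite !inE => /andP[].
rewrite cardsE; have /card_uniqP -> : uniq (i :: s) by rewrite /= is_ us.
by rewrite /= size_tuple.
Qed.

Lemma card_cons_tuples (e : {set G}) (i : G) : #|e| = k.+1 -> i \in e ->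
  #|[pred s : k.-tuple G | [set v in i :: s] == e]| = k`!.
Proof.
move=> ek ie; have ek' : #|e :\ i| = k by move: (cardsD1 i e); rewrite ie ek => -[].
rewrite -[X in _ = X`!]ek' -ffactnn [X in _ ^_ X]ek' -card_uniq_tuples.
by rewrite cardsE; apply: eq_card => s; rewrite !inE cons_tupleE // ie.
Qed.

(** An edge at [i] comes from the [k!] orderings of its other vertices, which cancels the entry
    [1/k!]. In this section [k] is the order of the tensor minus one. *)
Lemma adjacency_sum (x : G -> R[i]) (i : G) : uniform k.+1 G ->
  \sum_(s : k.-tuple G | [set v in i :: s] \in edges G)
     ((k`!)%:R^-1)%:C * \prod_(j <- s) x j =
  \sum_(e in edges G | i \in e) \prod_(v in e :\ i) x v.
Proof.
move=> unif.
rewrite (partition_big (fun s : k.-tuple G => [set v in i :: s])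
  (fun e => (e \in edges G) && (i \in e))) /=; last first.
  by move=> s sE; rewrite sE !inE eqxx.
apply: eq_bigr => e /andP[eG ie]; have ek := unif _ eG.
rewrite (eq_bigl (fun s : k.-tuple G => [set v in i :: s] == e)); last first.
  by move=> s; case: eqP => [->|_]; rewrite ?eG ?andbF.
rewrite (eq_bigr (fun=> ((k`!)%:R^-1)%:C * \prod_(v in e :\ i) x v)).
  rewrite -big_distrl /= sumr_const card_cons_tuples // -raddfMn /=.
  by rewrite -[X in X%:C]mulr_natl divff ?rmorph1 ?mul1r // pnatr_eq0 -lt0n fact_gt0.
move=> s; rewrite cons_tupleE // => /and3P[_ sE us]; congr (_ * _).
rewrite big_uniq //=; apply: eq_bigl => v.
have ss : s \subset e :\ i by apply/subsetP => w /(allP sE).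
have /subset_cardP : #|s| = #|e :\ i|.
  by rewrite (card_uniqP us) size_tuple; move: (cardsD1 i e); rewrite ie ek => -[].
by move=> /(_ ss v).
Qed.

Lemma degree_sum (x : G -> R[i]) (i : G) (d : R) :
  \sum_(s : k.-tuple G) (if all (pred1 i) (i :: s) then d else 0)%:C *
    \prod_(j <- s) x j = d%:C * x i ^+ k.
Proof.
rewrite (bigD1 (nseq_tuple k i)) // [X in if X then _ else _](_ : _ = true); last first.
  by rewrite /= eqxx all_pred1_nseq.
rewrite big_tuple (eq_bigr (fun=> x i)) => [|j _]; last by rewrite tnth_nseq.
rewrite prodr_const card_ord /= big1 ?addr0 // => s ns.
rewrite eqxx /=; case: ifP => [|_]; last by rewrite mul0r.
move/all_pred1P => se; case/eqP: ns; apply/val_inj => /=.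
by rewrite se size_tuple.
Qed.

Lemma tensor_applyE (alpha : R) (x : {ffun G -> R[i]}) (i : G) : uniform k.+1 G ->
  tensor_apply (alpha_tensor (k := k.+1) alpha (G := G)) x i =
  (alpha * (degree i)%:R)%:C * x i ^+ k +
  (1 - alpha)%:C * \sum_(e in edges G | i \in e) \prod_(v in e :\ i) x v.
Proof.
move=> unif; rewrite /tensor_apply.
rewrite (reindex_onto (fun s : k.-tuple G => [tuple of i :: s])
  (fun t => [tuple of behead t])) /=; last first.
  move=> t; rewrite (tuple_eta t) /= => /eqP[ti]; apply/val_inj => /=.
  by rewrite ti.
rewrite (eq_bigl xpredT); last first.
  by move=> s; rewrite eqxx /=; apply/eqP/val_inj.
rewrite -adjacency_sum // -degree_sum.
rewrite [X in _ + _ * X]big_mkcond !big_distrr /= -big_split /=.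
apply: eq_bigr => s _.
rewrite /alpha_tensor /degree_tensor /adjacency_tensor /=.
rewrite (_ : [set v in [tuple of i :: s]] = [set v in i :: s]) //.
rewrite rmorphD /= !rmorphM /= mulrDl -2!mulrA.
congr (_ + _ * _); last by case: ifP; rewrite ?mul0r.
by case: ifP => _; rewrite ?rmorphM ?mulrA // !(mul0r, mulr0).
Qed.
End TensorApply.

(** * First-order perturbation without derivatives *)

Lemma le0_of_small (R : realFieldType) (C D : R) : 0 <= D ->
  (forall s, 0 < s -> s < 1 -> C <= D * s)%R -> C <= 0.
Proof.
move=> D0 bound; rewrite leNgt; apply/negP => C0.
have CD1 : 0 < C + D + 1 by rewrite addr_gt0 // ltr_wpDr.
(* This [s] lies strictly between 0 and 1 and satisfies [D * s < C]. *)
have := bound (C / (C + D + 1)); rewrite divr_gt0 // => /(_ isT).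
rewrite ltr_pdivrMr // mul1r -addrA ltrDl ltr_wpDl // => /(_ isT).
apply/negP; rewrite -ltNge mulrA ltr_pdivrMr ?addrA // [D * C]mulrC ltr_pM2l //.
by rewrite addrAC ltrDr addr_gt0.
Qed.

Lemma expr1D_linear (R : realDomainType) n : exists2 M : R, 0 <= M &
  forall s : R, `|s| <= 1 -> `|(1 + s) ^+ n - 1 - n%:R * s| <= M * s ^+ 2.
Proof.
elim: n => [|n [M M0 IH]].
  by exists 0 => // s _; rewrite expr0 subrr mul0r subr0 normr0 mul0r.
exists (2%:R * M + n%:R); first by rewrite addr_ge0 // mulr_ge0.
move=> s s1; have -> : (1 + s) ^+ n.+1 - 1 - n.+1%:R * s =
    (1 + s) * ((1 + s) ^+ n - 1 - n%:R * s) + n%:R * s ^+ 2.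
  by rewrite exprS -natr1; ring.
rewrite (le_trans (ler_normD _ _)) // [leRHS]mulrDl lerD //; last first.
  by rewrite ger0_norm // mulr_ge0 // sqr_ge0.
rewrite normrM -mulrA ler_pM //; last exact: IH.
by rewrite (le_trans (ler_normD _ _)) // normr1 -[2%:R]/(1 + 1) lerD2l.
Qed.

(** The expression vanishes at [s = 0] and is nonnegative around it, so its derivative there,
    [A * k%:R - B], is zero. *)
Lemma bernoulli_stationary (R : realFieldType) (k : nat) (A B : R) :
  (forall s, -1 < s < 1 -> 0 <= A * ((1 + s) ^+ k - 1) - B * s) -> A * k%:R = B.
Proof.
move=> ge0; have [M M0 HM] := expr1D_linear R k.
pose d := A * k%:R - B; apply/eqP; rewrite -subr_eq0 -/d.
rewrite -normr_le0; apply: (@le0_of_small _ _ (`|A| * M)).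
  by rewrite mulr_ge0.
(* The sign makes the linear term [d * s] negative, of size [t] times the modulus of [d]. *)
move=> t t0 t1; pose s := - Num.sg d * t.
have s2 : s ^+ 2 <= t ^+ 2.
  rewrite exprMn sqrrN ler_piMl ?sqr_ge0 // sqr_sg; by case: (d != 0).
have nst : `|s| <= t.
  by rewrite -(@ler_pXn2r _ 2) ?nnegrE // ?(ltW t0) // real_normK // num_real.
have s1 : -1 < s < 1 by rewrite -ltr_norml (le_lt_trans nst).
have := ge0 s s1.
have -> : A * ((1 + s) ^+ k - 1) - B * s = A * ((1 + s) ^+ k - 1 - k%:R * s) + d * s.
  by rewrite /d; ring.
have -> : d * s = - `|d| * t.
  by rewrite /s mulrA mulrN [d * _]mulrC -normrEsg.
rewrite mulNr subr_ge0 => h.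
rewrite -(ler_pM2r t0) -[leRHS]mulrA -expr2 (le_trans h) //.
rewrite (le_trans (ler_norm _)) // normrM -mulrA ler_wpM2l //.
rewrite (le_trans (HM s _)) ?ler_wpM2l //.
by rewrite (le_trans nst) // ltW.
Qed.

(** * Positive maximizers and the spectral radius *)

Section Perron.
Variables (R : realType) (k : nat) (alpha : R) (G : hypergraph).
Hypotheses (k2 : (2 <= k)%N) (alpha01 : 0 <= alpha < 1).
Hypotheses (unif : uniform k G) (connG : connected G).
Implicit Types (x y : G -> R) (e : {set G}).

Let k0 : (0 < k)%N := ltnW k2.
Let alpha0 : 0 <= alpha. Proof. by case/andP: alpha01. Qed.
Let beta0 : 0 < 1 - alpha. Proof. by rewrite subr_gt0; case/andP: alpha01. Qed.

Local Notation form := (form k alpha (G := G)).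
Local Notation knorm := (knorm k (G := G)).

(** The second clause is the eigenvalue equation at [v] multiplied by [x v], so that whole edge
    weights appear. *)
Definition perron_vector (rho : R) x :=
  [/\ forall v, 0 < x v,
      forall v, (rho - alpha * (degree v)%:R) * x v ^+ k =
        (1 - alpha) * \sum_(e in edges G | v \in e) edge_weight x e &
      forall y, (forall v, 0 <= y v) -> form y <= rho * knorm y].

Lemma form_ge0 x : (forall v, 0 <= x v) -> 0 <= form x.
Proof.
move=> x0; rewrite addr_ge0 // mulr_ge0 ?(ltW beta0) ?mulr_ge0 //.
  by apply: sumr_ge0 => v _; rewrite mulr_ge0 // exprn_ge0.
by apply: sumr_ge0 => e _; apply: prodr_ge0.
Qed.

Lemma mixed_edge x u v : (forall v, 0 <= x v) -> x u != 0 -> x v = 0 ->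
  exists e a b, [/\ e \in edges G, a \in e, b \in e, 0 < x a & x b = 0].
Proof.
move=> x0 xu xv; case: connG => _ /(_ u v)/connectP[p pp vl].
elim: p u xu pp vl => /= [|b p IH] a xa; first by move=> _ va; rewrite -va xv eqxx in xa.
case/andP=> /andP[_ /existsP[e /and3P[eG ae be]]] pp vl.
have [xb|xb] := eqVneq (x b) 0; last exact: IH pp vl.
by exists e, a, b; split; rewrite // lt_def xa x0.
Qed.

(** If there were zeros, some edge would contain both zeros and nonzeros. Raising its zeros, at most
    [k - 1] of them, to a small [s] gains at least a multiple of [s^(k-1)] in the form and costs
    only a multiple of [s^k] in the norm. *)
Lemma maximizer_gt0 rho x : (forall v, 0 <= x v) -> knorm x = 1 ->
  form x = rho -> (forall y, (forall v, 0 <= y v) -> form y <= rho * knorm y) ->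
  forall v, 0 < x v.
Proof.
move=> x0 x1 fx dom v; rewrite lt_def x0 andbT; apply/eqP => xv.
have [u xu] : exists u, x u != 0.
  apply/existsP; apply: contra_eqT x1 => /existsPn xz.
  rewrite /knorm big1 ?(eq_sym 0) ?oner_eq0 // => w _.
  by have := xz w; rewrite negbK => /eqP->; rewrite expr0n eqn0Ngt k0.
have [e [a [b [eG ae be xa xb]]]] := mixed_edge x0 xu xv.
pose Z := [set z in e | x z == 0].
have bZ : b \in Z by rewrite inE be xb eqxx.
have rk : (#|Z| <= k.-1)%N.
  rewrite -ltnS prednK // -(unif eG) proper_card //.
  apply/properP; split; first by apply/subsetP => z; rewrite inE => /andP[].
  by exists a; rewrite // inE ae gt_eqF.
pose c := \prod_(z in e :\: Z) x z.
have c0 : 0 < c.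
  apply: prodr_gt0 => z; rewrite !inE => /andP[zZ ze].
  by move: zZ; rewrite ze /= lt_def x0 andbT.
pose C := (1 - alpha) * (k%:R * c); pose D := rho * #|Z|%:R.
have C0 : 0 < C by rewrite !mulr_gt0 // ltr0n.
have rho0 : 0 <= rho by rewrite -fx form_ge0.
have D0 : 0 <= D by rewrite mulr_ge0.
suff : C <= 0 by rewrite leNgt C0.
apply: (le0_of_small D0) => s s0 /ltW s1; pose y z := if z \in Z then s else x z.
have xZ z : z \in Z -> x z = 0 by rewrite inE => /andP[_ /eqP].
have y0 z : 0 <= y z by rewrite /y; case: ifP => // _; rewrite ltW.
have xy z : 0 <= x z <= y z.
  by rewrite x0 /= /y; case: ifP => [/xZ->|//]; rewrite ltW.
have ny : knorm y = 1 + #|Z|%:R * s ^+ k.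
  rewrite -[X in X + _ * _]x1 /knorm (bigID (mem Z)) /= [in RHS](bigID (mem Z)) /=.
  rewrite [in RHS]big1 => [|z /xZ->]; last by rewrite expr0n eqn0Ngt k0.
  rewrite add0r addrC; congr (_ + _).
    by apply: eq_bigr => z zZ; rewrite /y (negPf zZ).
  rewrite (eq_bigr (fun=> s ^+ k)) => [|z zZ]; last by rewrite /y zZ.
  by rewrite sumr_const mulr_natl.
have fy : form x + (1 - alpha) * (k%:R * (c * s ^+ #|Z|)) <= form y.
  rewrite /form -addrA lerD //.
    rewrite ler_wpM2l //; apply: ler_sum => z _; rewrite ler_wpM2l //.
    by have /andP[? ?] := xy z; rewrite lerXn2r ?nnegrE.
  rewrite -mulrDr ler_pM2l // -mulrDr ler_pM2l ?ltr0n //.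
  rewrite (bigD1 e) //= [leRHS](bigD1 e) //= addrAC lerD //.
    rewrite {1}/edge_weight (bigD1 b) //= xb mul0r add0r /edge_weight.
    rewrite [leRHS](bigID (mem Z)) /= mulrC ler_pM ?exprn_ge0 ?(ltW c0) ?(ltW s0) //.
      rewrite (eq_bigr (fun=> s)) => [|z /andP[_ zZ]]; last by rewrite /y zZ.
      rewrite (eq_bigl (mem Z)) => [|z].
        by rewrite prodr_const.
      by rewrite /Z !inE andbA andbb.
    rewrite /c (eq_bigl (fun z => (z \in e) && (z \notin Z))) => [|z].
      by apply: ler_prod.
    by rewrite inE andbC.
  by apply: ler_sum => f _; apply: le_edge_weight.
have := le_trans fy (dom y y0); rewrite ny mulrDr mulr1 fx lerD2l.
move=> le1; have sk : 0 < s ^+ k.-1 by rewrite exprn_gt0.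
rewrite -(ler_pM2r sk) -[leRHS]mulrA -exprS prednK // /D -[leRHS]mulrA.
apply: le_trans le1; rewrite /C -!mulrA ler_pM2l // ler_pM2l ?ltr0n // ler_pM2l //.
by rewrite ler_wiXn2l // ltW.
Qed.


(** Scaling the entry at [v] by [1 + s] changes the norm and the diagonal part through
    [(1 + s)^k - 1], and the edge part linearly, as [v] occurs once in each of its edges. It serves
    both for the maximizer on a supertree and for the transported weights in the equality case. *)
Lemma maximizer_perron rho x : (forall v, 0 < x v) -> form x = rho * knorm x ->
  (forall y, (forall v, 0 <= y v) -> form y <= rho * knorm y) ->
  perron_vector rho x.
Proof.
move=> x0 fx dom; split=> // v.
pose A := (rho - alpha * (degree v)%:R) * x v ^+ k.
pose S := \sum_(e in edges G | v \in e) edge_weight x e.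
have k1 : k%:R != 0 :> R by rewrite pnatr_eq0 -lt0n.
apply: (mulIf k1); rewrite -/A -/S.
apply: bernoulli_stationary => s /andP[s0 s1].
pose y z := if z == v then x v * (1 + s) else x z.
have y0 z : 0 <= y z.
  rewrite /y; case: ifP => _; last exact: ltW.
  by rewrite mulr_ge0 // ?(ltW (x0 v)) // -lerBlDl sub0r ltW.
have yv z : z != v -> y z = x z by rewrite /y => /negPf->.
have yvv : y v = x v * (1 + s) by rewrite /y eqxx.
have ny : knorm y = knorm x + x v ^+ k * ((1 + s) ^+ k - 1).
  rewrite /knorm (bigD1 v) //= [in RHS](bigD1 v) //= yvv exprMn.
  rewrite (eq_bigr (fun z => x z ^+ k)) => [|z /yv->//]; ring.
have dy : \sum_z (degree z)%:R * y z ^+ k = \sum_z (degree z)%:R * x z ^+ k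
    + (degree v)%:R * (x v ^+ k * ((1 + s) ^+ k - 1)).
  rewrite (bigD1 v) //= [in RHS](bigD1 v) //= yvv exprMn.
  rewrite (eq_bigr (fun z => (degree z)%:R * x z ^+ k)) => [|z /yv->//]; ring.
have ey : \sum_(e in edges G) edge_weight y e =
    \sum_(e in edges G) edge_weight x e + s * S.
  rewrite (bigID (fun e => v \in e)) /= [in RHS](bigID (fun e => v \in e)) /=.
  rewrite -/S addrAC -[X in X + _ + _]mul1r -mulrDl; congr (_ + _).
    rewrite big_distrr /=; apply: eq_bigr => e /andP[_ ve].
    rewrite /edge_weight (bigD1 v) //= [in RHS](bigD1 v) //= yvv.
    rewrite (eq_bigr x) => [|z /andP[_ /yv->//]]; ring.
  apply: eq_bigr => e /andP[_ ve]; apply: eq_bigr => z ze; apply: yv.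
  by apply: contraNneq ve => <-.
have := dom y y0; rewrite /form ny dy ey -subr_ge0.
set Dx := \sum_z _ in fx *; set Ex := \sum_(e in edges G) _ in fx *.
have fx' : alpha * Dx + (1 - alpha) * (k%:R * Ex) = rho * knorm x by exact: fx.
rewrite mulrDr -fx' /A; congr (0 <= _); ring.
Qed.

Theorem perron_exists : exists rho x, perron_vector rho x.
Proof.
have [x [x0 x1 dom]] := form_maximizer alpha unif connG.1 k0.
exists (form x), x; apply: maximizer_perron => //; last by rewrite x1 mulr1.
exact: maximizer_gt0 x0 x1 erefl dom.
Qed.

Lemma edge_sum_degree x :
  \sum_v \sum_(e in edges G | v \in e) edge_weight x e =
  k%:R * \sum_(e in edges G) edge_weight x e.
Proof.
rewrite (exchange_big_dep (mem (edges G))) /=; last by move=> v e _ /andP[].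
rewrite big_distrr /=; apply: eq_bigr => e eG.
rewrite (eq_bigl (mem e)) => [|v]; last by rewrite eG.
by rewrite sumr_const unif // mulr_natl.
Qed.

Lemma perron_form rho x : perron_vector rho x -> form x = rho * knorm x.
Proof.
case=> _ eig _; rewrite /form -edge_sum_degree /knorm !big_distrr -big_split /=.
apply: eq_bigr => v _; rewrite -eig; ring.
Qed.

Lemma perron_rho_ge0 rho x : perron_vector rho x -> 0 <= rho.
Proof.
move=> px; have [x0 _ _] := px; have [/card_gt0P[v _] _] := connG.
have : 0 < knorm x.
  rewrite /knorm (bigD1 v) //= ltr_pwDl ?exprn_gt0 // sumr_ge0 // => z _.
  by rewrite exprn_ge0 // ltW.
move=> n0; rewrite -(pmulr_lge0 _ n0) -(perron_form px) form_ge0 // => z.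
exact: ltW.
Qed.

Local Open Scope complex_scope.

Lemma perron_eigenvalue rho x : perron_vector rho x ->
  tensor_eigenvalue (alpha_tensor (k := k) alpha (G := G)) rho%:C.
Proof.
move=> [x0 eig _]; case: k k2 k0 unif eig => // k' _ _ unif' eig.
exists [ffun v => (x v)%:C]; split.
  have [/card_gt0P[v _] _] := connG; apply/eqP => /ffunP/(_ v).
  by rewrite !ffunE => /complexI/eqP; rewrite gt_eqF.
move=> v; rewrite tensor_applyE // ffunE /= -!rmorphXn /= -!rmorphM /=.
rewrite (eq_bigr (fun e : {set G} => (\prod_(z in e :\ v) x z)%:C)); last first.
  move=> e _; rewrite rmorph_prod; apply: eq_bigr => z _; by rewrite ffunE.
rewrite -rmorph_sum -rmorphM -rmorphD /=; congr (_ %:C).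
apply: (mulIf (lt0r_neq0 (x0 v))); rewrite mulrDl -!mulrA -exprSr.
rewrite -[X in _ + _ * X]mulrC big_distrr /=.
rewrite (eq_bigr (edge_weight x)) => [|e /andP[_ ve]]; last first.
  by rewrite /edge_weight [RHS](big_setD1 v).
rewrite -eig; ring.
Qed.


(** With [y v] the modulus of [z v], take moduli in the eigenvalue equation at [v], multiply by
    [y v] and sum: by the triangle inequality the modulus of [lambda] times [knorm y] is at most
    [form y]. *)
Lemma perron_eigenvalue_le rho x (lambda : R[i]) : perron_vector rho x ->
  tensor_eigenvalue (alpha_tensor (k := k) alpha (G := G)) lambda ->
  Normc.normc lambda <= rho.
Proof.
move=> [_ _ dom] [z [z0 eig]].
have norm_prod (I : finType) (P : pred I) (F : I -> R[i]) :
    Normc.normc (\prod_(i | P i) F i) = \prod_(i | P i) Normc.normc (F i).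
  by apply: (big_morph _ (@Normc.normcM R)); exact: Normc.normc1.
have norm_sum (I : finType) (P : pred I) (F : I -> R[i]) :
    Normc.normc (\sum_(i | P i) F i) <= \sum_(i | P i) Normc.normc (F i).
  elim/big_ind2: _ => [|a b c d ab cd|//]; first by rewrite Normc.normc0.
  exact: le_trans (le_normcD _ _) (lerD ab cd).
have norm_ge0 (c : R[i]) : 0 <= Normc.normc c.
  by case: c => a b; exact: sqrtr_ge0.
have norm_real (r : R) : 0 <= r -> Normc.normc r%:C = r.
  by move=> r0; rewrite /= expr0n addr0 sqrtr_sqr ger0_norm.
have norm_exp n (c : R[i]) : Normc.normc (c ^+ n) = Normc.normc c ^+ n.
  by elim: n => [|n IH]; rewrite ?Normc.normc1 // !exprS Normc.normcM IH.
pose y v := Normc.normc (z v).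
have y0 v : 0 <= y v by exact: norm_ge0.
have n0 : 0 < knorm y.
  have [v zv] : exists v, z v != 0.
    apply/existsP; apply: contraNT z0 => /existsPn zz.
    by apply/eqP/ffunP => v; rewrite ffunE; apply/eqP; rewrite -[_ == _]negbK zz.
  rewrite /knorm (bigD1 v) //= ltr_pwDl ?sumr_ge0 // => [|w _]; last exact: exprn_ge0.
  rewrite exprn_gt0 // lt_def y0 andbT.
  by apply: contraNneq zv => /Normc.eq0_normc ->.
rewrite -(ler_pM2r n0); apply: le_trans (dom y y0).
rewrite /form -edge_sum_degree /knorm !big_distrr -big_split /=.
apply: ler_sum => v _.
have := eig v; case: k k2 k0 unif eig => // k' _ _ unif' _.
rewrite tensor_applyE //= => /(congr1 (@Normc.normc R)); rewrite Normc.normcM.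
rewrite norm_exp.
rewrite -/(y v) => E; rewrite exprSr [leLHS]mulrA -E.
rewrite (le_trans (ler_wpM2r (y0 v) (le_normcD _ _))) // mulrDl !Normc.normcM.
rewrite norm_exp !norm_real ?(ltW beta0) ?mulr_ge0 // -!mulrA lerD //.
rewrite ler_wpM2l ?(ltW beta0) // (le_trans (ler_wpM2r (y0 v) (norm_sum _ _ _))) //.
rewrite big_distrl /=; apply: ler_sum => e /andP[_ ve].
by rewrite norm_prod /edge_weight [leRHS](big_setD1 v) //= mulrC.
Qed.

Theorem perron_spectral_radius rho x : perron_vector rho x ->
  alpha_spectral_radius k alpha G = rho.
Proof.
move=> px; have rho0 := perron_rho_ge0 px.
rewrite /alpha_spectral_radius /spectral_radius.
set E := (X in sup X).
have Erho : E rho.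
  exists rho%:C; first exact: perron_eigenvalue px.
  by rewrite /= expr0n addr0 sqrtr_sqr ger0_norm.
have ubE : classical_sets.ubound E rho.
  by move=> _ [lambda lE <-]; apply: perron_eigenvalue_le px lE.
apply/le_anti/andP; split; first by apply: ge_sup ubE; exists rho.
by apply: ub_le_sup Erho; exists rho.
Qed.

End Perron.

(** * Rearranging blocks of weights *)

Section Rearrangement.
Variable R : realFieldType.
Implicit Types (M L K : seq R) (s t : seq (R * seq R)).

Local Notation desc := (sorted (>=%R : rel R)).

Definition block_sum s : R := \sum_(p <- s) p.1 * \prod_(z <- p.2) z.

(** The order of the children is immaterial; sorting turns equality of blocks into equality of
    multisets of children weights. *)
Definition norm_block (p : R * seq R) := (p.1, sort >=%R p.2).

Lemma desc_sort L : desc (sort >=%R L).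
Proof. exact: sort_sorted ge_total L. Qed.

Lemma desc_perm_eq L M : desc L -> desc M -> perm_eq L M -> L = M.
Proof. exact: (sorted_eq (@ge_trans _ R) (@ge_anti _ R)). Qed.

Lemma prod_gt0 L : all (fun x : R => 0 < x) L -> 0 < \prod_(z <- L) z.
Proof. by move=> /allP L0; rewrite big_seq prodr_gt0. Qed.

Lemma prod_subseq_le M L : desc M -> all (fun x : R => 0 < x) M -> subseq L M ->
  \prod_(z <- L) z <= \prod_(z <- take (size L) M) z /\
  (\prod_(z <- L) z = \prod_(z <- take (size L) M) z -> L = take (size L) M).
Proof.
elim: M L => [|x M IH] [|y L] dM //=; rewrite ?take0 ?big_nil //.
case/andP=> x0 M0; have dM' : desc M by exact: path_sorted dM.
rewrite !big_cons; case: eqP => [->|yx] sub.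
  have [le eq] := IH L dM' M0 sub; rewrite ler_pM2l //; split=> //.
  by move/(mulfI (lt0r_neq0 x0))/eq => <-.
have yM : y \in M by rewrite (mem_subseq sub) ?mem_head.
have ltyx : y < x.
  rewrite lt_neqAle; move/eqP: yx => -> /=.
  by have /allP := order_path_min ge_trans dM; apply.
have [le _] := IH L dM' M0 (subseq_trans (subseq_cons L y) sub).
suff lt : y * \prod_(z <- L) z < x * \prod_(z <- take (size L) M) z.
  by split=> [|eq]; [exact: ltW | move: lt; rewrite eq ltxx].
apply: lt_le_trans (_ : x * \prod_(z <- L) z <= _); last by rewrite ler_pM2l.
rewrite ltr_pM2r // prod_gt0 //; apply/allP => z zL.
by apply: (allP M0); rewrite (mem_subseq sub) // inE zL orbT.
Qed.

Lemma all_take_desc M n (z : R) : desc M -> (n <= count (fun x : R => (z <= x)%R) M)%N ->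
  all (fun x : R => (z <= x)%R) (take n M).
Proof.
elim: M n => [|x M IH] [|n] //= dM; have dM' : desc M by exact: path_sorted dM.
case: (boolP (z <= x)) => [zx|zx]; first by rewrite add1n ltnS; apply: IH.
rewrite add0n => lt; have : (0 < count (fun x : R => (z <= x)%R) M)%N by exact: leq_trans lt.
rewrite -has_count => /hasP[y yM zy]; case/negP: zx; apply: le_trans zy _.
by have /allP := order_path_min ge_trans dM; apply.
Qed.

(** Let [P], [Q] be the products of [L], [K] and [P'], [Q'] the new ones. Since [P * Q = P' * Q']
    and [P'] is at least [P] and [Q], the sum [P' + Q'] is at least [P + Q]; having the larger
    product in the block with the larger factor [b] helps further. *)
Lemma two_blocks (b c : R) n L K : 0 < c -> c <= b -> size L = n -> size K = n ->
  all (fun x : R => 0 < x) L -> all (fun x : R => 0 < x) K ->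
  let M := sort >=%R (L ++ K) in
  let s := [:: (b, L); (c, K)] in let t := [:: (b, take n M); (c, drop n M)] in
  block_sum s <= block_sum t /\
  (block_sum s = block_sum t -> perm_eq (map norm_block s) (map norm_block t)).
Proof.
move=> c0 cb sL sK L0 K0 M s t.
have dM : desc M by exact: desc_sort.
have M0 : all (fun x : R => 0 < x) M by rewrite all_sort all_cat L0 K0.
have sub1 : subseq (sort >=%R L) M.
  exact: (subseq_sort ge_total ge_trans (prefix_subseq L K)).
have sub2 : subseq (sort >=%R K) M.
  exact: (subseq_sort ge_total ge_trans (suffix_subseq L K)).
have pMLK : perm_eq M (L ++ K) by rewrite perm_sort.
clearbody M.
have d1 : desc (take n M) by exact: take_sorted.
have d2 : desc (drop n M) by exact: drop_sorted.
have pM : perm_eq (take n M ++ drop n M) (L ++ K) by rewrite cat_take_drop.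
have pprod L' : \prod_(z <- sort >=%R L') z = \prod_(z <- L') z.
  by apply: perm_big; rewrite perm_sort.
have := prod_subseq_le dM M0 sub1; have := prod_subseq_le dM M0 sub2.
rewrite !size_sort sL sK !pprod => -[le2 eq2] [le1 eq1].
have : \prod_(z <- take n M) z * \prod_(z <- drop n M) z =
    \prod_(z <- L) z * \prod_(z <- K) z.
  by rewrite -!big_cat; exact: perm_big.
have P0 := prod_gt0 L0; have Q0 := prod_gt0 K0.
rewrite /block_sum /s /t !big_cons !big_nil !addr0 /=.
move: le1 eq1 le2 eq2.
set P := \prod_(z <- L) z in P0 *; set Q := \prod_(z <- K) z in Q0 *.
set P' := \prod_(z <- take n M) z; set Q' := \prod_(z <- drop n M) z.
move=> le1 eq1 le2 eq2 PQ.
have P'0 : 0 < P' by exact: lt_le_trans le1.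
have key : P' * (P' + Q' - (P + Q)) = (P' - P) * (P' - Q).
  by rewrite mulrBr mulrDr PQ; ring.
have ge0 : 0 <= P' + Q' - (P + Q).
  by rewrite -(pmulr_rge0 _ P'0) key mulr_ge0 // subr_ge0.
have split : b * P' + c * Q' - (b * P + c * Q) =
    (b - c) * (P' - P) + c * (P' + Q' - (P + Q)) by ring.
have h1 : 0 <= (b - c) * (P' - P) by rewrite mulr_ge0 // subr_ge0.
have h2 : 0 <= c * (P' + Q' - (P + Q)) by rewrite mulr_ge0 // ltW.
split; first by rewrite -subr_ge0 split addr_ge0.
move=> eq; have : (b - c) * (P' - P) + c * (P' + Q' - (P + Q)) == 0.
  by rewrite -split eq subrr.
rewrite paddr_eq0 // !mulf_eq0 (gt_eqF c0) /= => /andP[e1 e2].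
have {}e2 : (P' == P) || (P' == Q).
  by rewrite -subr_eq0 -[P' == Q]subr_eq0 -mulf_eq0 -key (eqP e2) mulr0.
rewrite /norm_block /= (sorted_sort ge_trans d1) (sorted_sort ge_trans d2).
have rest L' K' : perm_eq (L' ++ K') (L ++ K) -> sort >=%R L' = take n M ->
    sort >=%R K' = drop n M.
  move=> pLK sL'; apply: desc_perm_eq => //; first exact: desc_sort.
  rewrite perm_sort -(perm_cat2l (take n M)) (permPr pM) -(permPr pLK).
  by rewrite perm_cat2r -sL' perm_sort.
case: (eqVneq P' P) e1 e2 => [e _ _|ne].
  have sL' := eq1 (esym e).
  by rewrite sL' (rest L K).
(* Here [b = c] and [P' = Q]: the two lists are only exchanged, up to order, between blocks of equal
   top weight. *)
rewrite subr_eq0 [P' - P == 0]subr_eq0 (negPf ne) orbF /= => /eqP e1' /eqP e.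
have sK' := eq2 (esym e).
have -> : sort >=%R L = drop n M by apply: (rest K L) => //; rewrite perm_catC.
by rewrite sK' e1' (perm_catC [:: _] [:: _]).
Qed.

Definition blocks_ok n s :=
  all (fun p => [&& 0 < p.1, size p.2 == n & all (fun x : R => 0 < x) p.2]) s.

(* One pass over [s] moves the [n] largest entries into the first block. *)
Lemma bubble n (b : R) L s : blocks_ok n ((b, L) :: s) ->
  all (fun p => p.1 <= b) s -> exists L' s',
  [/\ blocks_ok n ((b, L') :: s') /\ map fst s' = map fst s,
      perm_eq (L' ++ flatten (map snd s')) (L ++ flatten (map snd s)),
      forall z : R, all (fun x : R => (z <= x)%R) L -> all (fun x : R => (z <= x)%R) L',
      all (fun z : R => all (fun x : R => (z <= x)%R) L') (flatten (map snd s')) &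
      block_sum ((b, L) :: s) <= block_sum ((b, L') :: s') /\
      (block_sum ((b, L) :: s) = block_sum ((b, L') :: s') ->
       perm_eq (map norm_block ((b, L) :: s)) (map norm_block ((b, L') :: s')))].
Proof.
elim: s L => [|[c K] s IH] L /=.
  by move=> ok _; exists L, [::].
case/and3P=> /and3P[b0 /eqP sL L0] /and3P[/= c0 /eqP sK K0] oks /andP[cb sb].
pose M := sort >=%R (L ++ K).
have dM : desc M by exact: desc_sort.
have M0 : all (fun x : R => 0 < x) M by rewrite all_sort all_cat L0 K0.
have sM : size M = (n + n)%N by rewrite size_sort size_cat sL sK.
have pM : perm_eq M (L ++ K) by rewrite perm_sort.
have [T0 D0] : all (fun x : R => 0 < x) (take n M) /\ all (fun x : R => 0 < x) (drop n M).
  by move: M0; rewrite -{1}(cat_take_drop n M) all_cat => /andP.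
have [le1 eq1] := two_blocks c0 cb sL sK L0 K0.
rewrite -/M in le1 eq1; clearbody M.
have ok1 : blocks_ok n ((b, take n M) :: s).
  by rewrite /= b0 T0 oks size_takel ?eqxx // sM leq_addr.
have [L' [s' [[ok' fs'] pL' geL' domL' [le2 eq2]]]] := IH _ ok1 sb.
have geT (z : R) : all (fun x : R => (z <= x)%R) L -> all (fun x : R => (z <= x)%R) (take n M).
  move=> zL; apply: all_take_desc => //; rewrite (permP pM) count_cat.
  by move: zL; rewrite all_count => /eqP->; rewrite sL leq_addr.
exists L', ((c, drop n M) :: s'); split.
- split; last by rewrite /= fs'.
  move: ok' => /= /andP[-> ->]; rewrite c0 D0 size_drop sM addnK eqxx //.
- rewrite /= perm_catCA; apply: (perm_trans (perm_cat (perm_refl _) pL')).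
  by rewrite !catA perm_cat2r perm_catC cat_take_drop.
- by move=> z /geT/geL'.
(* The entries left in the second block lie below [take n M], and the later exchanges preserve every
   lower bound of the first block. *)
- rewrite /= all_cat domL' andbT; apply/allP => z zD.
  apply: geL'; apply/allP => y yT.
  move: dM; rewrite -(cat_take_drop n M) (sorted_pairwise ge_trans) pairwise_cat.
  by case/andP=> /allrelP/(_ y z yT zD).
have bs2 p q u : block_sum [:: p, q & u] = block_sum [:: p; q] + block_sum u.
  by rewrite /block_sum !big_cons big_nil addr0 addrA.
have bs3 p q u : block_sum [:: p, q & u] = block_sum [:: q] + block_sum (p :: u).
  by rewrite /block_sum !big_cons big_nil addr0 addrCA.
have le12 : block_sum [:: (b, L), (c, K) & s] <= block_sum [:: (b, take n M), (c, drop n M) & s].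
  by rewrite (bs2 (b, L)) (bs2 (b, take n M)) lerD2r.
have le23 : block_sum [:: (b, take n M), (c, drop n M) & s] <=
    block_sum [:: (b, L'), (c, drop n M) & s'].
  by rewrite (bs3 (b, take n M)) (bs3 (b, L')) lerD2l.
split; first exact: le_trans le12 le23.
move=> eq.
have e12 : block_sum [:: (b, L), (c, K) & s] = block_sum [:: (b, take n M), (c, drop n M) & s].
  by apply/le_anti; rewrite le12 /= eq.
have e23 : block_sum [:: (b, take n M), (c, drop n M) & s] =
    block_sum [:: (b, L'), (c, drop n M) & s'].
  by rewrite -e12.
move: e12; rewrite (bs2 (b, L)) (bs2 (b, take n M)) => /addIr/eq1 p12.
move: e23; rewrite (bs3 (b, take n M)) (bs3 (b, L')) => /addrI/eq2 p23.
apply: (@perm_trans _ (map norm_block [:: (b, take n M), (c, drop n M) & s])).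
  exact: perm_cat p12 (perm_refl (map norm_block s)).
by apply/permP => P; have /permP/(_ P) /= := p23; rewrite addnCA => ->; rewrite addnCA.
Qed.

(** After one pass of [bubble] the first block holds the [n] largest entries, that is [K] up to
    order; then its factor is raised from [b] to [c], and the tails are compared by induction. *)
Lemma rearrange n s t : blocks_ok n s -> blocks_ok n t ->
  desc (map fst s) -> desc (map fst t) -> size s = size t ->
  (forall i, (i < size s)%N -> (map fst s)`_i <= (map fst t)`_i) ->
  desc (flatten (map snd t)) ->
  perm_eq (flatten (map snd s)) (flatten (map snd t)) ->
  block_sum s <= block_sum t /\
  (block_sum s = block_sum t -> perm_eq (map norm_block s) (map norm_block t)).
Proof.
elim: t s => [|[c K] t IH] [|[b L] s] //.
move=> oks okt ds dt [sst] le df pf.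
have sb : all (fun p => p.1 <= b) s.
  by have := order_path_min ge_trans ds; rewrite all_map.
have [L' [s' [[ok' fs'] pL' _ domL' [le1 eq1]]]] := bubble oks sb.
case/andP: (ok') => /= /and3P[b0 /eqP sL' L'0] oks'.
case/andP: (okt) => /= /and3P[c0 /eqP sK K0] okt'.
have [dK dft] : desc K /\ desc (flatten (map snd t)).
  by move: df; rewrite /= !(sorted_pairwise ge_trans) pairwise_cat => /and3P[].
have pKt : perm_eq (L' ++ flatten (map snd s')) (K ++ flatten (map snd t)).
  exact: perm_trans pL' pf.
have LK : sort >=%R L' = K.
  have : sort >=%R L' ++ sort >=%R (flatten (map snd s')) = K ++ flatten (map snd t).
    apply: desc_perm_eq => //; last first.
      by rewrite (perm_trans _ pKt) // perm_cat // perm_sort.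
    rewrite (sorted_pairwise ge_trans) pairwise_cat -!(sorted_pairwise ge_trans).
    rewrite !desc_sort !andbT; apply/allrelP => y z; rewrite !mem_sort => yL zs.
    by have /allP/(_ z zs)/allP/(_ y yL) := domL'.
  by move/eqP; rewrite eqseq_cat ?size_sort ?sL' ?sK // => /andP[/eqP].
have pst : perm_eq (flatten (map snd s')) (flatten (map snd t)).
  by rewrite -(perm_cat2l K) -(permPr pKt) perm_cat2r -LK perm_sort.
have sz : size s' = size s by rewrite -(size_map fst) fs' size_map.
have bc : b <= c by exact: (le 0%N).
have [|||i|//|//|le2 eq2] := IH s' oks' okt'.
- by rewrite fs'; exact: path_sorted ds.
- exact: path_sorted dt.
- by rewrite sz.
- by rewrite fs' sz; exact: (le i.+1).
have PL : \prod_(z <- L') z = \prod_(z <- K) z.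
  by rewrite -LK; apply/esym/perm_big; rewrite perm_sort.
have bsE p u : block_sum (p :: u) = p.1 * \prod_(z <- p.2) z + block_sum u.
  by rewrite /block_sum big_cons.
have le3 : b * \prod_(z <- L') z <= c * \prod_(z <- K) z.
  by rewrite PL ler_pM2r // prod_gt0.
have le4 : block_sum ((b, L') :: s') <= block_sum ((c, K) :: t).
  by rewrite !bsE lerD.
split; first exact: le_trans le1 le4.
move=> eq; have e1 : block_sum ((b, L) :: s) = block_sum ((b, L') :: s').
  by apply/le_anti; rewrite le1 eq.
have : block_sum ((b, L') :: s') = block_sum ((c, K) :: t) by rewrite -e1.
move/eqP; rewrite !bsE -subr_eq0 opprD addrACA -oppr_eq0 opprD !opprB.
rewrite paddr_eq0 ?subr_ge0 // !subr_eq0 => /andP[/eqP e3 /eqP e4].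
have cb : c = b by apply: (mulIf (lt0r_neq0 (prod_gt0 K0))); rewrite e3 -PL.
apply: perm_trans (eq1 e1) _; rewrite /= /norm_block /= LK cb.
by rewrite (sorted_sort ge_trans) // perm_cons eq2.
Qed.

End Rearrangement.

(** * BFS-orderings *)

Section WellOrder.
Variables (T : eqType) (le : rel T).
Hypothesis wo : well_order le.

(** [well_order] provides a unique least element of each nonempty set; the order axioms come from
    sets of at most three elements. *)
Lemma wo_total : total le.
Proof.
move=> x y; have [|z [[zA zl] _]] := wo (A := pred2 x y); first by exists x; rewrite inE eqxx.
have lx := zl x; have ly := zl y; move: lx ly zA; rewrite !inE !eqxx orbT /=.
by move=> /(_ isT) lx /(_ isT) ly /orP[/eqP<-|/eqP<-]; rewrite ?lx ?ly ?orbT.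
Qed.

Lemma wo_refl : reflexive le.
Proof. by move=> x; have := wo_total x x; rewrite orbb. Qed.

Lemma wo_anti : antisymmetric le.
Proof.
move=> x y /andP[xy yx].
have [|z [_ zu]] := wo (A := pred2 x y); first by exists x; rewrite inE eqxx.
have zx : z = x.
  by apply: zu; split=> [|w]; rewrite !inE ?eqxx // => /orP[/eqP->|/eqP->//]; exact: wo_refl.
have zy : z = y.
  by apply: zu; split=> [|w]; rewrite !inE ?eqxx ?orbT // => /orP[/eqP->//|/eqP->]; exact: wo_refl.
by rewrite -zx.
Qed.

Lemma wo_trans : transitive le.
Proof.
move=> y x z xy yz.
have [|w [[wA wl] _]] := wo (A := pred3 x y z); first by exists x; rewrite inE eqxx.
have wx : le w x by apply: wl; rewrite !inE eqxx.
have wy : le w y by apply: wl; rewrite !inE eqxx orbT.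
have wz : le w z by apply: wl; rewrite !inE eqxx !orbT.
move: wA; rewrite !inE => /or3P[/eqP<-//|/eqP wE|/eqP wE].
  by have -> : x = y by apply: wo_anti; rewrite xy -wE wx.
have yz' : y = z by apply: wo_anti; rewrite yz -wE wy.
by rewrite -yz'.
Qed.

End WellOrder.

(** * Sums over a rooted supertree, edge by edge *)

Section RootedSums.
Variable G : hypergraph.
Variables (v0 : G) (q : {set G} -> G) (a : G -> {set G}) (h : G -> nat).
Hypothesis rG : rooted v0 q a h.

Lemma mem_children e v : e \in edges G ->
  (v \in e :\ q e) = (v != v0) && (a v == e).
Proof.
case: rG => _ a1 a2 _ _ eG; rewrite !inE; apply/andP/andP => [[vq ve]|[vv0 /eqP av]].
  by have [-> ->] := a2 e eG v ve (contra_neq esym vq).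
by have [_ va qa] := a1 v vv0; rewrite -av va eq_sym.
Qed.

Lemma sum_children (M : nmodType) (g : G -> M) :
  \sum_(v | v != v0) g v = \sum_(e in edges G) \sum_(v in e :\ q e) g v.
Proof.
rewrite (partition_big a (mem (edges G))) => [|v vv0]; last first.
  by case: rG => _ a1 _ _ _; case: (a1 v vv0).
by apply: eq_bigr => e eG; apply: eq_bigl => v; rewrite mem_children.
Qed.

(** A vertex is the top of all its edges except the one above it, which only the root lacks. *)
Lemma sum_degree (M : nmodType) (g : G -> M) :
  \sum_v g v *+ degree v =
  \sum_(e in edges G) g (q e) + \sum_(v | v != v0) g v.
Proof.
rewrite sum_children -big_split /=.
transitivity (\sum_v \sum_(e in edges G | v \in e) g v).
  by apply: eq_bigr => v _; rewrite sumr_const.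
rewrite (exchange_big_dep (mem (edges G))) /=; last by move=> v e _ /andP[].
apply: eq_bigr => e eG; rewrite (eq_bigl (mem e)) => [|v]; last by rewrite eG.
by case: rG => q1 _ _ _ _; rewrite (big_setD1 (q e)) //= q1.
Qed.

Section Blocks.
Variables (es : seq {set G}) (ch : {set G} -> seq G).
Hypothesis es_perm : perm_eq es (enum (edges G)).
Hypothesis ch_perm : {in edges G, forall e, perm_eq (ch e) (enum (e :\ q e))}.

Lemma flatten_children : perm_eq (flatten (map ch es)) (enum [set~ v0]).
Proof.
apply/permP => P; rewrite count_flatten sumnE !big_map (perm_big _ es_perm) /=.
rewrite big_enum /= -sum1_count /= [RHS]big_enum_cond /=.
rewrite [RHS](eq_bigl (fun v => (v != v0) && P v)) => [|v]; last by rewrite !inE.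
rewrite big_mkcondr sum_children /=; apply: eq_bigr => e eG.
by rewrite (permP (ch_perm eG)) -sum1_count big_enum_cond /= -big_mkcondr.
Qed.

Variable R : realType.

(* One pair per edge: the weight of its top vertex and those of its children. *)
Definition blocks (x : G -> R) := [seq (x (q e), map x (ch e)) | e <- es].

Lemma block_sum_blocks x :
  block_sum (blocks x) = \sum_(e in edges G) edge_weight x e.
Proof.
rewrite /block_sum big_map (perm_big _ es_perm) /= big_enum /=.
apply: eq_bigr => e eG; rewrite big_map (perm_big _ (ch_perm eG)) /= big_enum /=.
by case: rG => q1 _ _ _ _; rewrite /edge_weight [RHS](big_setD1 (q e)) //= q1.
Qed.

Lemma map_fst_blocks x : map fst (blocks x) = [seq x (q e) | e <- es].
Proof. by rewrite -map_comp. Qed.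

Lemma flatten_blocks x :
  flatten (map snd (blocks x)) = map x (flatten (map ch es)).
Proof. by rewrite map_flatten -!map_comp. Qed.

Lemma blocks_okP k x : uniform k G -> (forall v, 0 < x v) -> blocks_ok k.-1 (blocks x).
Proof.
move=> unif x0; apply/allP => _ /mapP[e ees ->] /=; rewrite x0 size_map.
have eG : e \in edges G by rewrite (perm_mem es_perm) mem_enum in ees.
rewrite (perm_size (ch_perm eG)) -cardE.
have := cardsD1 (q e) e; case: rG => q1 _ _ _ _; rewrite q1 // unif // => ->.
by rewrite eqxx; apply/allP => _ /mapP[v _ ->].
Qed.

(** Apart from the blocks, only [knorm] and the weight of the root enter, and transport preserves
    both. *)
Lemma form_blocks k alpha x : form k alpha x =
  alpha * (\sum_(b <- map fst (blocks x)) b ^+ k + (knorm k x - x v0 ^+ k)) +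
  (1 - alpha) * (k%:R * block_sum (blocks x)).
Proof.
rewrite /form block_sum_blocks; congr (_ * _ + _).
rewrite (eq_bigr (fun v => x v ^+ k *+ degree v)) => [|v _]; last by rewrite mulr_natl.
rewrite sum_degree; congr (_ + _).
  by rewrite map_fst_blocks big_map (perm_big _ es_perm) /= big_enum.
by rewrite /knorm [in RHS](bigD1 v0) //= [RHS]addrC addKr.
Qed.

Lemma count_parents (P : pred G) :
  (count (P \o q) es + #|[pred v | P v & v != v0]| = \sum_(v | P v) degree v)%N.
Proof.
have one_mulrn n : 1%N *+ n = n by elim: n => // n IH; rewrite mulrS IH.
have -> : (\sum_(v | P v) degree v = \sum_v (P v : nat) *+ degree v)%N.
  rewrite big_mkcond; apply: eq_bigr => v _.
  by case: (P v); rewrite ?mul0rn ?one_mulrn.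
rewrite sum_degree; congr (_ + _)%N.
  rewrite (permP es_perm) -sum1_count big_enum_cond /= big_mkcondr.
  by apply: eq_bigr => e _; case: ifP.
rewrite -sum1_card big_mkcond [RHS]big_mkcond /=.
by apply: eq_bigr => v _; rewrite inE andbC; case: (v != v0).
Qed.

End Blocks.
End RootedSums.

(** Reduces a vertex between two members of an edge to one between two consecutive members, as
    condition (iv) requires. *)
Lemma sorted_gap (T : Type) (r : rel T) (x0 w : T) s i n : total r ->
  r (nth x0 s i) w -> r w (nth x0 s (i + n.+1)) ->
  exists2 j, (i <= j < i + n.+1)%N & r (nth x0 s j) w /\ r w (nth x0 s j.+1).
Proof.
move=> tot; elim: n i => [|n IH] i iw wj.
  by exists i; rewrite ?leqnn ?addn1 ?ltnSn //; rewrite addn1 in wj.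
have [le|le] := orP (tot w (nth x0 s i.+1)).
  by exists i; rewrite ?leqnn //= -[X in (X < _)%N]addn0 ltn_add2l.
have [|j /andP[ij jn] jw] := IH i.+1 le; first by rewrite addSnnS.
by exists j; rewrite // (ltnW ij) /= -addSnnS.
Qed.

Lemma sorted_flatten (T I : eqType) (r : rel T) (f : I -> seq T)
    (lt : rel I) s : transitive r -> transitive lt -> sorted lt s -> uniq s ->
  {in s, forall i, sorted r (f i)} ->
  {in s &, forall i j, i != j -> lt i j -> allrel r (f i) (f j)} ->
  sorted r (flatten (map f s)).
Proof.
move=> rt ltt; rewrite !(sorted_pairwise, rt, ltt) //.
elim: s => //= i s IH /andP[lti pws] /andP[is_ us] fs fr.
rewrite pairwise_cat -sorted_pairwise // fs ?mem_head // IH //; last first.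
- by move=> j l js ls; apply: fr; rewrite inE ?js ?ls orbT.
- by move=> j js; apply: fs; rewrite inE js orbT.
rewrite !andbT; apply/allrelP => y z yi /flattenP[_ /mapP[j js ->] zj].
have jis : j \in i :: s by rewrite inE js orbT.
have ij : i != j by apply: contraNneq is_ => ->.
have /allrelP := fr i j (mem_head _ _) jis ij (allP lti j js).
exact.
Qed.

(** * Edges and children along a BFS-ordering *)

Section BFS.
Variables (G : hypergraph) (k : nat) (v0 : G) (le : rel G).
Variables (q : {set G} -> G) (a : G -> {set G}) (h : G -> nat).
Hypotheses (k2 : (2 <= k)%N) (unif : uniform k G).
Hypothesis bfs : BFS_ordering v0 le.
Hypothesis rG : rooted v0 q a h.

Let wo : well_order le. Proof. by case: bfs. Qed.
Let le_total := wo_total wo.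
Let le_trans := wo_trans wo.
Let le_anti := wo_anti wo.

Lemma bfs_height u v : le u v -> (h u <= h v)%N.
Proof. by case: bfs => _ [hle _ _ _] /hle; rewrite !(rooted_distance rG). Qed.

Lemma bfs_degree u v : le u v -> (degree v <= degree u)%N.
Proof. by case: bfs => _ [_ + _ _]; apply. Qed.

Lemma lt_height_le u v : (h u < h v)%N -> le u v.
Proof.
move=> lt; have /orP[//|/bfs_height] := le_total u v.
by rewrite leqNgt lt.
Qed.

Lemma bfs_root v : le v0 v.
Proof.
have [->|vv0] := eqVneq v v0; first exact: wo_refl.
by apply: lt_height_le; case: rG => _ _ _ -> h1; rewrite (h1 v vv0).
Qed.

Definition children e := sort le (enum (e :\ q e)).

Lemma children_perm e : perm_eq (children e) (enum (e :\ q e)).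
Proof. by rewrite perm_sort. Qed.

Lemma mem_childrenE e v : (v \in children e) = (v \in e :\ q e).
Proof. by rewrite mem_sort mem_enum. Qed.

Lemma child_height e v : e \in edges G -> v \in children e -> h v = (h (q e)).+1.
Proof.
move=> eG; rewrite mem_childrenE !inE => /andP[vq ve].
by apply: (rooted_child rG eG ve); rewrite eq_sym.
Qed.

Lemma size_children e : e \in edges G -> size (children e) = k.-1.
Proof.
move=> eG; rewrite size_sort -cardE; have := cardsD1 (q e) e.
by case: rG => q1 _ _ _ _; rewrite q1 // unif // => ->.
Qed.

(** The top has the smallest height, so it comes first; the positions [i >= 1] of condition (iv) are
    those of the children. *)
Lemma sorted_edge e : e \in edges G -> sort le (enum e) = q e :: children e.
Proof.
move=> eG; have q1 : q e \in e by case: rG => q1 _ _ _ _; exact: q1.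
apply: (sorted_eq le_trans le_anti).
- exact: sort_sorted.
- rewrite /= path_min_sorted; first exact: sort_sorted.
  by apply/allP => v /(child_height eG) hv; apply: lt_height_le; rewrite hv.
- rewrite perm_sort perm_sym; apply: uniq_perm.
  + by rewrite /= sort_uniq enum_uniq mem_childrenE !inE eqxx.
  + exact: enum_uniq.
  + move=> v; rewrite inE mem_childrenE !inE mem_enum.
    by case: eqVneq => [->|_]; rewrite ?q1.
Qed.

Definition first_child e := head v0 (children e).

Lemma first_childP e : e \in edges G -> first_child e \in children e.
Proof.
move=> eG; have := size_children eG; rewrite /first_child.
by case: (children e) => [|v s]; rewrite ?mem_head //=; case: (k) k2 => [|[]].
Qed.

Lemma first_child_le e v : v \in children e -> le (first_child e) v.
Proof.
have : sorted le (children e) by exact: sort_sorted.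
rewrite /first_child; case: (children e) => //= w s /(order_path_min le_trans)/allP ws.
by rewrite inE => /orP[/eqP->|/ws//]; apply: wo_refl.
Qed.

(** Ordered by first child and not by top vertex, since several edges may share their top. *)
Definition bfs_edges := sort (relpre first_child le) (enum (edges G)).

Lemma bfs_edges_perm : perm_eq bfs_edges (enum (edges G)).
Proof. by rewrite perm_sort. Qed.

Lemma mem_bfs_edges e : (e \in bfs_edges) = (e \in edges G).
Proof. by rewrite mem_sort mem_enum. Qed.

Lemma bfs_edges_sorted : sorted (relpre first_child le) bfs_edges.
Proof. by apply: sort_sorted => e f; apply: le_total. Qed.

Lemma bfs_parent_mono e f : e \in edges G -> f \in edges G ->
  forall u v, u \in children e -> v \in children f -> le u v -> le (q e) (q f).
Proof.
move=> eG fG u v ue vf uv; case: (rG) => q1 _ _ _ _.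
case: bfs => _ [_ _ + _] => /(_ e f u (q e) v (q f) eG fG).
have hu := child_height eG ue; have hv := child_height fG vf.
move: ue vf; rewrite !mem_childrenE !inE => /andP[_ ue] /andP[_ vf].
by rewrite !(rooted_distance rG) !q1 //; apply.
Qed.

Lemma bfs_parents_sorted : sorted le (map q bfs_edges).
Proof.
rewrite sorted_map; apply: sub_in_sorted (allss _) bfs_edges_sorted => e f.
rewrite !mem_bfs_edges => eG fG /= ef.
exact: (bfs_parent_mono eG fG (first_childP eG) (first_childP fG)).
Qed.

(** A child [w] of [f] preceding a child [u] of [e] would lie between the first child of [e] and
    [u], hence, being outside [e], in a gap that condition (iv) forbids. *)
Lemma bfs_children_before e f : e \in edges G -> f \in edges G -> e != f ->
  le (first_child e) (first_child f) -> allrel le (children e) (children f).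
Proof.
move=> eG fG ef ef1; apply/allrelP => u w ue wf.
have /orP[//|wu] := le_total u w.
have cw : le (first_child e) w by apply: le_trans ef1 _; apply: first_child_le.
have we : w \notin e.
  (* As the top of [e], [w] would be lower than the first child, which precedes it; as a child of
     [e], it would have two edges above it. *)
  apply/negP => we; have [wq|wq] := eqVneq w (q e).
    have := bfs_height cw; rewrite (child_height eG (first_childP eG)) wq.
    by rewrite ltnn.
  have wce : w \in e :\ q e by rewrite !inE wq.
  move: wce wf; rewrite mem_childrenE (mem_children rG _ eG) (mem_children rG _ fG).
  by case/andP=> _ /eqP-> /andP[_]; rewrite (negPf ef).
case: bfs => _ [_ _ _ /(_ e eG)] /=; rewrite (sorted_edge eG) => gap.
have i1 : nth w (q e :: children e) 1 = first_child e.
  have := size_children eG; rewrite /first_child /=.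
  by case: (children e) => //=; case: (k) k2 => [|[]].
pose j := index u (children e).
have jlt : (j < size (children e))%N by rewrite index_mem.
have jE : nth w (q e :: children e) (1 + j) = u by rewrite /= nth_index.
case: (posnP j) => [j0|j0].
  have uE : u = first_child e by rewrite -jE j0 addn0.
  by rewrite uE.
have := @sorted_gap _ le w w (q e :: children e) 1 j.-1 le_total.
rewrite (prednK j0) jE i1 => /(_ cw wu)[i /andP[i0 ij] [iw wi]].
have ie : (i.+1 < #|e|)%N.
  rewrite unif // (leq_ltn_trans ij) //.
  by move: jlt; rewrite size_children // add1n ltn_predRL.
by case: (gap i w i0 ie we).
Qed.

Lemma bfs_children_sorted : sorted le (flatten (map children bfs_edges)).
Proof.
apply: (sorted_flatten le_trans _ bfs_edges_sorted).
- by move=> f e g /=; apply: le_trans.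
- by rewrite sort_uniq enum_uniq.
- by move=> e _; apply: sort_sorted.
- by move=> e f; rewrite !mem_bfs_edges; apply: bfs_children_before.
Qed.

End BFS.

(** * Transporting the weights to a BFS-supertree *)

Lemma sumn_subseq_le (M L : seq nat) : sorted geq M -> subseq L M ->
  (sumn L <= sumn (take (size L) M))%N.
Proof.
have gt : transitive geq by move=> y x z /= yx zy; exact: leq_trans zy yx.
elim: M L => [|m M IH] [|l L] //= dM; have dM' := path_sorted dM.
case: eqP => [->|_] sub; first by rewrite leq_add2l IH.
rewrite leq_add //; last by rewrite IH // (subseq_trans (subseq_cons L l)).
have /allP := order_path_min gt dM; apply.
by rewrite (mem_subseq sub) ?mem_head.
Qed.

Lemma filter_take_sorted (T : eqType) (r : rel T) (P : pred T) s : transitive r ->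
  sorted r s -> (forall u v, r u v -> P v -> P u) ->
  filter P s = take (count P s) s.
Proof.
move=> rt + down; elim: s => //= x s IH dxs; have ds := path_sorted dxs.
case: (boolP (P x)) => Px; first by rewrite add1n /= IH.
have nP : ~~ has P s.
  apply/hasPn => y ys; apply: contra Px; apply: down.
  exact: (allP (order_path_min rt dxs)).
by move: nP; rewrite has_count -eqn0Ngt => /eqP nP; rewrite IH // nP !take0.
Qed.

Lemma desc_le_nth (R : realFieldType) (s t : seq R) :
  sorted >=%R s -> sorted >=%R t ->
  (forall c : R, (count (fun x : R => (c <= x)%R) s <= count (fun x : R => (c <= x)%R) t)%N) ->
  forall i, (i < size s)%N -> (i < size t)%N -> s`_i <= t`_i.
Proof.
move=> ds dt ct i si ti.
have lei : (i.+1 <= count (fun x : R => (s`_i <= x)%R) s)%N.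
  rewrite -{2}(cat_take_drop i.+1 s) count_cat (leq_trans _ (leq_addr _ _)) //.
  suff /eqP -> : count (fun x : R => (s`_i <= x)%R) (take i.+1 s) == size (take i.+1 s).
    by rewrite size_takel.
  rewrite -all_count; apply/(all_nthP 0) => j; rewrite size_takel // => ji.
  rewrite nth_take //.
  exact: (sorted_leq_nth ge_trans lexx 0 ds j i (leq_trans ji si) si).
have /(all_nthP 0)/(_ i) := all_take_desc dt (leq_trans lei (ct s`_i)).
by rewrite size_takel // nth_take //; apply.
Qed.

(** [val] has the shape of [form_blocks], with [c] a common constant. Both summands grow from [s] to
    [t], so equality forces equal block sums, as [(1 - alpha) * k%:R > 0]. *)
Lemma rearrange_form (R : realFieldType) (k n : nat) (alpha c : R) s t :
  (2 <= k)%N -> 0 <= alpha < 1 -> blocks_ok n s -> blocks_ok n t ->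
  sorted >=%R (map fst s) -> sorted >=%R (map fst t) -> size s = size t ->
  (forall i, (i < size s)%N -> (map fst s)`_i <= (map fst t)`_i) ->
  sorted >=%R (flatten (map snd t)) ->
  perm_eq (flatten (map snd s)) (flatten (map snd t)) ->
  let val u := alpha * (\sum_(b <- map fst u) b ^+ k + c) +
    (1 - alpha) * (k%:R * block_sum u) in
  val s <= val t /\
  (val s = val t -> perm_eq (map (@norm_block R) s) (map (@norm_block R) t)).
Proof.
move=> k2 alpha01 oks okt ds dt sz le df pf val.
have [le1 eq1] := rearrange oks okt ds dt sz le df pf.
have [alpha0 alpha1] := andP alpha01; have beta0 : 0 < 1 - alpha by rewrite subr_gt0.
have c0 : 0 < (1 - alpha) * k%:R by rewrite mulr_gt0 // ltr0n ltnW.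
have pos u i : blocks_ok n u -> (i < size u)%N -> 0 <= (map fst u)`_i.
  move=> /all_nthP ok ilt; rewrite (nth_map (0, [::])) //.
  by have /and3P[/ltW] := ok (0, [::]) i ilt.
have le2 : alpha * (\sum_(b <- map fst s) b ^+ k + c) <=
    alpha * (\sum_(b <- map fst t) b ^+ k + c).
  rewrite ler_wpM2l // lerD2r !(big_nth (0 : R)) !size_map sz !big_mkord.
  by apply: ler_sum => i _; rewrite lerXn2r ?nnegrE ?le ?pos ?sz.
have le3 : (1 - alpha) * (k%:R * block_sum s) <= (1 - alpha) * (k%:R * block_sum t).
  by rewrite !mulrA ler_pM2l.
split; first exact: lerD.
move=> E; apply: eq1; move/eqP: E; rewrite /val -subr_eq0 opprD addrACA -oppr_eq0.
rewrite opprD !opprB paddr_eq0 ?subr_ge0 // !subr_eq0 => /andP[_ /eqP].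
by rewrite !mulrA => /(mulfI (lt0r_neq0 c0))/esym.
Qed.

Section Comparison.
Variables (R : realType) (k : nat) (alpha : R).
Hypotheses (k2 : (2 <= k)%N) (alpha01 : 0 <= alpha < 1).

Variable G : hypergraph.
Variables (v0 : G) (le : rel G).
Variables (q : {set G} -> G) (a : G -> {set G}) (h : G -> nat).
Hypotheses (unifG : uniform k G) (bfs : BFS_ordering v0 le).
Hypothesis rG : rooted v0 q a h.

Variable H : hypergraph.
Variables (w0 : H) (p : {set H} -> H) (b : H -> {set H}) (g : H -> nat).
Hypotheses (unifH : uniform k H) (rH : rooted w0 p b g).
Variable x : H -> R.
Hypotheses (x_gt0 : forall v, 0 < x v) (x_max : forall v, x v <= x w0).

Hypothesis same_degrees :
  perm_eq [seq degree v | v <- enum G] [seq degree v | v <- enum H].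

Let wo : well_order le. Proof. by case: bfs. Qed.
Let le_total := wo_total wo.
Let le_trans := wo_trans wo.
Let le_anti := wo_anti wo.

Let ws := sort >=%R (map x (enum H)).
Let gs := sort le (enum G).

(* The weights of [H] in decreasing order, placed along the BFS-ordering. *)
Definition transport v : R := ws`_(index v gs).
Local Notation y := transport.

Lemma size_same : size ws = size gs.
Proof. by rewrite !size_sort size_map; have := perm_size same_degrees; rewrite !size_map. Qed.

Lemma mem_gs v : v \in gs. Proof. by rewrite mem_sort mem_enum. Qed.

Lemma transport_map : map y gs = ws.
Proof.
apply: (@eq_from_nth _ 0); first by rewrite size_map size_same.
move=> i; rewrite size_map => ilt; rewrite (nth_map v0) // /transport index_uniq //.
by rewrite sort_uniq enum_uniq.
Qed.

Lemma transport_perm : perm_eq (map y (enum G)) (map x (enum H)).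
Proof.
rewrite -(permPr (permEl (perm_sort >=%R _))) -/ws -transport_map.
by apply: perm_map; rewrite perm_sym perm_sort.
Qed.

Lemma transport_anti u v : le u v -> y v <= y u.
Proof.
move=> uv; have lt w : (index w gs < size ws)%N by rewrite size_same index_mem mem_gs.
apply: (sorted_leq_nth ge_trans lexx 0 (desc_sort _)); [exact: lt | exact: lt |].
rewrite leqNgt; apply/negP => ltvu; have vu := ltnW ltvu.
suff E : u = v by rewrite E ltnn in ltvu.
have := sorted_leq_index le_trans (wo_refl wo) (sort_sorted le_total (enum G)).
by move=> /(_ v u (mem_gs v) (mem_gs u) vu) vu'; apply: le_anti; rewrite uv.
Qed.

Lemma transport_mem v : exists2 w, y v = x w & true.
Proof.
have : y v \in map x (enum H) by rewrite -(perm_mem transport_perm) map_f // mem_enum.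
by case/mapP=> w _ ->; exists w.
Qed.

Lemma transport_gt0 v : 0 < y v.
Proof. by have [w ->] := transport_mem v. Qed.

Lemma transport_root : y v0 = x w0.
Proof.
apply/Order.POrderTheory.le_anti/andP; split; first by have [w ->] := transport_mem v0.
have : x w0 \in map y (enum G) by rewrite (perm_mem transport_perm) map_f ?mem_enum.
by case/mapP=> v _ ->; apply/transport_anti/(bfs_root bfs rG).
Qed.

Lemma transport_big (M : nmodType) (f : R -> M) :
  \sum_v f (y v) = \sum_v f (x v).
Proof.
transitivity (\sum_(c <- map y (enum G)) f c); first by rewrite big_map big_enum.
by rewrite (perm_big _ transport_perm) big_map big_enum.
Qed.

(** The two roots have the same weight, so leaving them out removes the same contribution. *)
Lemma transport_card (P : pred R) :
  #|[pred v | P (y v) & v != v0]| = #|[pred v | P (x v) & v != w0]|.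
Proof.
have := transport_big (fun c => P c : nat).
rewrite (bigD1 v0) //= [RHS](bigD1 w0) //= transport_root => /addnI E.
rewrite -!sum1_card big_mkcond [RHS]big_mkcond /=.
move: E; rewrite big_mkcond [RHS]big_mkcond /= => E.
transitivity (\sum_(v : G) (if v != v0 then P (y v) : nat else 0%N))%N.
  by apply: eq_bigr => v _; rewrite inE andbC; case: (v != v0); case: (P _).
rewrite E; apply: eq_bigr => v _; rewrite inE andbC.
by case: (v != w0); case: (P _).
Qed.

(** In [G] the vertices with [c <= y v] form an initial segment of the BFS-ordering, so their
    degrees are the largest; [H] has as many vertices of weight at least [c], and the same degree
    sequence. *)
Lemma top_degrees c :
  (\sum_(v | (c <= x v)%R) degree v <= \sum_(v | (c <= y v)%R) degree v)%N.
Proof.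
pose P v := (c <= y v)%R; pose Q v := (c <= x v)%R.
have dG : sorted geq (map (@degree G) gs).
  rewrite sorted_map; apply: sub_sorted (sort_sorted le_total _) => u v /=.
  by move/(bfs_degree bfs).
have gtrans : transitive geq by move=> i j l /= ji il; exact: leq_trans il ji.
have gtotal : total geq by move=> i j; exact: leq_total.
have ganti : antisymmetric geq.
  by move=> i j /= /andP[ij ji]; apply/eqP; rewrite eqn_leq ij ji.
have dE : sort geq (map (@degree H) (enum H)) = map (@degree G) gs.
  apply: (sorted_eq gtrans ganti); rewrite ?sort_sorted // perm_sort perm_sym.
  by apply: perm_trans same_degrees; apply: perm_map; rewrite perm_sort.
have PQ : count P gs = count Q (enum H).
  rewrite -(count_map y (fun r => c <= r)%R) -(count_map x (fun r => c <= r)%R).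
  by rewrite transport_map; apply/permP; rewrite perm_sort.
have sumE (T : finType) (s : seq T) (B : pred T) (f : T -> nat) :
    perm_eq s (enum T) -> (\sum_(v | B v) f v = sumn (map f (filter B s)))%N.
  move=> ps; rewrite sumnE big_map big_filter (perm_big _ ps) /=.
  by rewrite big_enum_cond.
rewrite (sumE _ (enum H) Q) // (sumE _ gs P) ?perm_sort //.
rewrite (filter_take_sorted le_trans (sort_sorted le_total _)); last first.
  by move=> u v uv; rewrite /P => /Order.POrderTheory.le_trans; apply; exact: transport_anti.
rewrite map_take -dE -/gs PQ.
rewrite -(perm_sumn (permEl (perm_sort geq _))).
have -> : count Q (enum H) = size (sort geq (map (@degree H) (filter Q (enum H)))).
  by rewrite size_sort size_map size_filter.
apply: sumn_subseq_le; first exact: sort_sorted.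
apply: (subseq_sort gtotal gtrans); apply: map_subseq; exact: filter_subseq.
Qed.

Let hs := sort (relpre (x \o p) >=%R) (enum (edges H)).
Let es := bfs_edges v0 le q.
Let chG := children le q.
Let chH (e : {set H}) := enum (e :\ p e).

Let hs_perm : perm_eq hs (enum (edges H)). Proof. by rewrite perm_sort. Qed.
Let es_perm : perm_eq es (enum (edges G)). Proof. exact: bfs_edges_perm. Qed.
Let chG_perm : {in edges G, forall e, perm_eq (chG e) (enum (e :\ q e))}.
Proof. by move=> e _; exact: children_perm. Qed.
Let chH_perm : {in edges H, forall e, perm_eq (chH e) (enum (e :\ p e))}.
Proof. by []. Qed.

Let bH := blocks p hs chH x.
Let bG := blocks q es chG y.

Let fst_H : sorted >=%R (map fst bH).
Proof.
rewrite map_fst_blocks -[map _ _]/(map (x \o p) hs) sorted_map.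
by apply: sort_sorted => e f; exact: ge_total.
Qed.

Let fst_G : sorted >=%R (map fst bG).
Proof.
rewrite map_fst_blocks (map_comp y q) sorted_map.
exact: sub_sorted transport_anti _ (bfs_parents_sorted k2 unifG bfs rG).
Qed.

Let snd_G : sorted >=%R (flatten (map snd bG)).
Proof.
rewrite flatten_blocks sorted_map.
exact: sub_sorted transport_anti _ (bfs_children_sorted k2 unifG bfs rG).
Qed.

Let snd_perm : perm_eq (flatten (map snd bH)) (flatten (map snd bG)).
Proof.
rewrite !flatten_blocks.
have pG := perm_map y (flatten_children rG es_perm chG_perm).
have pH := perm_map x (flatten_children rH hs_perm chH_perm).
rewrite (permPl pH) (permPr pG); apply/permP => P.
rewrite !count_map -!sum1_count !big_enum_cond !sum1_card /=.
transitivity #|[pred v | P (x v) & v != w0]|.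
  by apply: eq_card => v; rewrite [LHS]unfold_in !inE andbC.
by rewrite -transport_card; apply: eq_card => v; rewrite [RHS]unfold_in !inE andbC.
Qed.

Let size_blocks : size bH = size bG.
Proof.
have sz (s : seq (R * seq R)) : blocks_ok k.-1 s ->
    size (flatten (map snd s)) = (size s * k.-1)%N.
  elim: s => //= -[c L] s IH /andP[/and3P[_ /eqP sL _] /IH sE].
  by rewrite size_cat sE sL mulSn.
have := perm_size snd_perm; rewrite !sz; last 2 first.
- exact: (blocks_okP rG es_perm chG_perm unifG transport_gt0).
- exact: (blocks_okP rH hs_perm chH_perm unifH x_gt0).
by move/eqP; rewrite eqn_pmul2r ?ltn_predRL // => /eqP.
Qed.

(** By [count_parents], adding the number of non-root vertices of weight at least [c], equal on both
    sides, turns the counts of heavy tops into degree sums. *)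
Let fst_le i : (i < size bH)%N -> (map fst bH)`_i <= (map fst bG)`_i.
Proof.
move=> ilt; apply: (desc_le_nth fst_H fst_G); last 2 first.
- by rewrite size_map.
- by rewrite size_map -size_blocks.
move=> c.
have cG := count_parents rG es_perm (fun v => c <= y v)%R.
have cH := count_parents rH hs_perm (fun v => c <= x v)%R.
rewrite !map_fst_blocks -[map (fun e => x (p e)) hs]/(map (x \o p) hs).
rewrite !count_map -(leq_add2r #|[pred v | (c <= x v)%R & v != w0]|).
by rewrite [leqLHS]cH -(transport_card (fun r => c <= r)%R) [leqRHS]cG top_degrees.
Qed.

Theorem form_transport :
  form k alpha x <= form k alpha y /\
  (form k alpha x = form k alpha y ->
   perm_eq (map (@norm_block R) bH) (map (@norm_block R) bG)).
Proof.
rewrite (form_blocks rH hs_perm chH_perm k alpha x).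
rewrite (form_blocks rG es_perm chG_perm k alpha y).
have -> : knorm k y = knorm k x by exact: (transport_big (fun r => r ^+ k)).
rewrite transport_root.
exact: (rearrange_form _ k2 alpha01 (blocks_okP rH hs_perm chH_perm unifH x_gt0)
  (blocks_okP rG es_perm chG_perm unifG transport_gt0)
  fst_H fst_G size_blocks fst_le snd_G snd_perm).
Qed.

End Comparison.

(** * Vertices of equal weight *)

Lemma prod_le_eq (R : realFieldType) (L K : seq R) :
  all2 (fun z w => 0 < w <= z) L K ->
  \prod_(w <- K) w <= \prod_(z <- L) z /\
  (\prod_(w <- K) w = \prod_(z <- L) z -> K = L).
Proof.
elim: L K => [|z L IH] [|w K] //= /andP[/andP[w0 wz] LK].
have [le eq] := IH K LK; rewrite !big_cons.
have K0 : 0 < \prod_(w <- K) w.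
  elim: (L) (K) LK {IH le eq} => [|z' L' IH] [|w' K'] //=; first by rewrite big_nil.
  by case/andP=> /andP[w'0 _] /IH; rewrite big_cons; apply: mulr_gt0.
have L0 : 0 < \prod_(z <- L) z by exact: lt_le_trans le.
split; first by rewrite ler_pM // ltW.
move=> E; have zw : w = z.
  apply/le_anti; rewrite wz -(ler_pM2r L0) -E ler_pM2l //.
by move: E; rewrite zw => /(mulfI (lt0r_neq0 (lt_le_trans w0 wz)))/eq ->.
Qed.

(** For nonempty [B], let [M] be the largest value on [B]: the sum over [B] is at most [M *+ #|B|],
    then [M *+ #|A|], then the sum over [A]. Equality makes every term equal to [M]. *)
Lemma sum_dominated (R : realFieldType) (T : finType) (A B : {set T}) (F : T -> R) :
  (forall e, 0 < F e) -> (#|B| <= #|A|)%N ->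
  {in A & B, forall e f, F f <= F e} ->
  \sum_(f in B) F f <= \sum_(e in A) F e /\
  (\sum_(f in B) F f = \sum_(e in A) F e ->
   #|A| = #|B| /\ {in A & B, forall e f, F e = F f}).
Proof.
move=> F0 BA dom; have [->|[f0 f0B]] := set_0Vmem B.
  rewrite big_set0; split; first by apply: sumr_ge0 => e _; exact: ltW.
  move/esym/eqP; rewrite psumr_eq0 => [/allP A0|e _]; last exact: ltW.
  have AE : A = set0.
    apply/setP => e; rewrite inE; apply/negP => eA.
    by have := A0 e (mem_index_enum _); rewrite eA gt_eqF.
  by rewrite AE cards0; split=> // e f; rewrite inE.
have [f fB fmax] := @arg_maxP _ _ _ f0 (mem B) F f0B.
pose M := F f; have M0 : 0 < M by exact: F0.
have hB : \sum_(f in B) F f <= M *+ #|B|.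
  by rewrite -sumr_const; apply: ler_sum => g gB; exact: fmax.
have hBA : M *+ #|B| <= M *+ #|A| by rewrite ler_pMn2l.
have hA : M *+ #|A| <= \sum_(e in A) F e.
  by rewrite -sumr_const; apply: ler_sum => e eA; exact: dom.
split; first exact: le_trans hB (le_trans hBA hA).
move=> E; have eB : \sum_(f in B) F f = M *+ #|B|.
  by apply/le_anti; rewrite hB E (le_trans hBA hA).
have eA : M *+ #|A| = \sum_(e in A) F e.
  by apply/le_anti; rewrite hA -E (le_trans hB hBA).
have AB : #|A| = #|B|.
  by apply/eqP; rewrite eqn_leq -!(ler_pMn2l M0) eA -E eB lexx.
split=> // e g eA' gB.
have zA : \sum_(e in A) (F e - M) == 0 by rewrite sumrB -eA sumr_const subrr.
have zB : \sum_(f in B) (M - F f) == 0 by rewrite sumrB eB sumr_const subrr.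
move: zA zB; rewrite !psumr_eq0; last 2 first.
- by move=> f' f'B; rewrite subr_ge0; exact: fmax.
- by move=> e' e'A; rewrite subr_ge0; exact: dom.
move=> /allP/(_ e (mem_index_enum _)); rewrite eA' subr_eq0 /= => /eqP->.
by move=> /allP/(_ g (mem_index_enum _)); rewrite gB subr_eq0 /= => /eqP->.
Qed.

(** * Edge types and their multiplicities at a vertex *)

Section EdgeType.
Variables (R : realType) (G : hypergraph).
Implicit Types (x : G -> R) (e : {set G}).

(** All weights of the edge, the top included, so that no rooting is involved and edges of two
    hypergraphs can be compared. *)
Definition edge_type x e : seq R := sort >=%R (map x (enum e)).

Lemma edge_weight_type x e : edge_weight x e = \prod_(z <- edge_type x e) z.
Proof.
rewrite /edge_weight (perm_big _ (permEl (perm_sort >=%R _))) /= big_map.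
by rewrite big_enum.
Qed.

Lemma edge_type_eq x e s : perm_eq (map x (enum e)) s -> edge_type x e = sort >=%R s.
Proof.
move=> es; apply: desc_perm_eq; rewrite ?desc_sort // perm_sort.
by rewrite perm_sym perm_sort perm_sym.
Qed.

Lemma head_edge_type x e v : v \in e -> {in e, forall w, x w <= x v} ->
  head 0 (edge_type x e) = x v.
Proof.
move=> ve max; have xvt : x v \in edge_type x e.
  by rewrite mem_sort map_f // mem_enum.
have := desc_sort (map x (enum e)); rewrite -/(edge_type x e).
have : all (fun z : R => z <= x v) (edge_type x e).
  by rewrite all_sort all_map; apply/allP => w; rewrite mem_enum => /max.
move: xvt; case: (edge_type x e) => //= z s; rewrite inE.
case/orP=> [/eqP->//|xvs] /andP[zv _] /(order_path_min ge_trans)/allP/(_ _ xvs) vz.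
by apply/le_anti; rewrite zv.
Qed.

Definition type_count x v (t : seq R) : nat :=
  #|[set e in edges G | (v \in e) && (edge_type x e == t)]|.

(** Double counting: an edge of type [t] has [count_mem c t] vertices of weight [c]. The sum thus
    depends only on the multiset of edge types. *)
Lemma sum_type_count x c t :
  (\sum_(v | x v == c) type_count x v t =
   count_mem c t * #|[set e in edges G | edge_type x e == t]|)%N.
Proof.
transitivity (\sum_(v | x v == c) \sum_(e in edges G | (v \in e) && (edge_type x e == t)) 1)%N.
  by apply: eq_bigr => v _; rewrite sum1dep_card.
rewrite (exchange_big_dep (fun e => (e \in edges G) && (edge_type x e == t))) /=; last first.
  by move=> v e _ /and3P[-> _ ->].
rewrite (eq_bigr (fun=> count_mem c t)).
  by rewrite sum_nat_cond_const mulnC; congr (_ * _)%N; apply: eq_card => e; rewrite !inE.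
move=> e /andP[eG /eqP et]; rewrite -et count_sort count_map -sum1_count big_enum_cond /=.
by apply: eq_bigl => v; rewrite eG et eqxx andbT andbC.
Qed.

Lemma sum_weight_type x v (ts : seq (seq R)) : uniq ts ->
  (forall e, e \in edges G -> v \in e -> edge_type x e \in ts) ->
  \sum_(e in edges G | v \in e) edge_weight x e =
  \sum_(t <- ts) (\prod_(z <- t) z) *+ type_count x v t.
Proof.
move=> us all_ts.
transitivity (\sum_(t <- ts)
  \sum_(e in edges G | (v \in e) && (edge_type x e == t)) edge_weight x e).
  rewrite (exchange_big_dep (fun e => (e \in edges G) && (v \in e))) /=; last first.
    by move=> t e _ /and3P[-> ->].
  apply: eq_bigr => e /andP[eG ve]; rewrite -big_filter.
  rewrite (eq_filter (a2 := pred1 (edge_type x e))); last first.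
    by move=> t; rewrite /= eG ve eq_sym.
  by rewrite filter_pred1_uniq ?all_ts // big_seq1.
apply: eq_bigr => t _.
transitivity
  (\sum_(e in edges G | (v \in e) && (edge_type x e == t)) \prod_(z <- t) z).
  by apply: eq_bigr => e /and3P[_ _ /eqP <-]; rewrite edge_weight_type.
by rewrite sumr_const; congr (_ *+ _); apply: eq_card => e; rewrite inE.
Qed.

Lemma degree_type x v (ts : seq (seq R)) : uniq ts ->
  (forall e, e \in edges G -> v \in e -> edge_type x e \in ts) ->
  degree v = (\sum_(t <- ts) type_count x v t)%N.
Proof.
move=> us all_ts; rewrite /degree -sum1_card.
transitivity (\sum_(t <- ts) \sum_(e in edges G | (v \in e) && (edge_type x e == t)) 1)%N.
  rewrite (exchange_big_dep (fun e => (e \in edges G) && (v \in e))) /=; last first.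
    by move=> t e _ /and3P[-> ->].
  apply: eq_bigr => e /andP[eG ve]; rewrite -big_filter.
  rewrite (eq_filter (a2 := pred1 (edge_type x e))); last first.
    by move=> t; rewrite /= eG ve eq_sym.
  by rewrite filter_pred1_uniq ?all_ts // big_seq1.
by apply: eq_bigr => t _; rewrite sum1dep_card.
Qed.

End EdgeType.

(** * Weight classes in a BFS-supertree *)

Section ClassesBFS.
Variables (R : realType) (k : nat) (alpha rho : R).
Hypotheses (k2 : (2 <= k)%N) (alpha01 : 0 <= alpha < 1).
Variable G : hypergraph.
Variables (v0 : G) (le : rel G).
Variables (q : {set G} -> G) (a : G -> {set G}) (h : G -> nat).
Hypotheses (unif : uniform k G) (bfs : BFS_ordering v0 le).
Hypothesis rG : rooted v0 q a h.
Variable y : G -> R.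
Hypotheses (y_gt0 : forall v, 0 < y v) (y_anti : forall u v, le u v -> y v <= y u).
Hypothesis y_eig : forall v, (rho - alpha * (degree v)%:R) * y v ^+ k =
  (1 - alpha) * \sum_(e in edges G | v \in e) edge_weight y e.

Let wo : well_order le. Proof. by case: bfs. Qed.
Let le_total := wo_total wo.
Let le_trans := wo_trans wo.
Let le_anti := wo_anti wo.
Let ch := children le q.
Let lee e f := le (first_child v0 le q e) (first_child v0 le q f).

(** The earlier edge dominates entry by entry: top against top, and each child against the child in
    the same position. *)
Lemma lee_weight e f : e \in edges G -> f \in edges G -> lee e f ->
  edge_weight y f <= edge_weight y e /\
  (edge_weight y f = edge_weight y e -> edge_type y f = edge_type y e).
Proof.
move=> eG fG ef; have [->|ne] := eqVneq e f; first by [].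
have pe g : g \in edges G -> perm_eq (map y (enum g)) (map y (q g :: ch g)).
  by move=> gG; rewrite -(sorted_edge bfs rG gG) perm_map // perm_sym perm_sort.
have We g : g \in edges G -> edge_weight y g = \prod_(z <- map y (q g :: ch g)) z.
  move=> gG; rewrite -(perm_big _ (pe g gG)) /= big_map.
  by rewrite big_enum.
have [|le1 eq1] := @prod_le_eq R (map y (q e :: ch e)) (map y (q f :: ch f)).
  rewrite /= y_gt0 y_anti /=; last first.
    exact: (bfs_parent_mono bfs rG eG fG (first_childP _ k2 unif rG eG)
      (first_childP _ k2 unif rG fG) ef).
  have /allrelP rel := bfs_children_before k2 unif bfs rG eG fG ne ef.
  suff all2_le s t : {subset s <= ch e} -> {subset t <= ch f} -> size s = size t ->
      all2 (fun z w : R => 0 < w <= z) (map y s) (map y t).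
    by apply: all2_le; rewrite // !(size_children _ unif rG).
  elim: s t => [|u s IH] [|v t] //= ss ts [st].
  rewrite y_gt0 y_anti ?IH //.
  - by move=> z zs; rewrite ss // inE zs orbT.
  - by move=> z zs; rewrite ts // inE zs orbT.
  - by apply: rel; [rewrite ss ?mem_head | rewrite ts ?mem_head].
rewrite !We //; split=> // E; rewrite (edge_type_eq (pe e eG)) (edge_type_eq (pe f fG)).
by rewrite eq1.
Qed.

Lemma lee_total e f : lee e f || lee f e. Proof. exact: le_total. Qed.

Let e0 := head set0 (bfs_edges v0 le q).

Lemma lee_min e : e \in edges G -> lee e0 e.
Proof.
rewrite -(mem_bfs_edges v0 le q) /e0; have := bfs_edges_sorted q bfs.
case: (bfs_edges v0 le q) => //= f s fs.
rewrite inE => /orP[/eqP->|es]; first exact: (wo_refl wo).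
have tr : transitive (relpre (first_child v0 le q) le).
  by move=> e1 e2 e3 /=; apply: le_trans.
by have /allP := order_path_min tr fs; apply.
Qed.

(** The vertex [v] ensures that an edge exists. Climbing from it reaches an edge with top [v0]; [e0]
    precedes that edge, so by condition (iii) its top is [v0] too. *)
Lemma first_edge v : v != v0 -> e0 \in edges G /\ q e0 = v0.
Proof.
move=> vv0; case: (rG) => q1 a1 a2 h0 h1.
have [aG _ _] := a1 v vv0.
have e0G : e0 \in edges G.
  rewrite -(mem_bfs_edges v0 le q) /e0.
  have : a v \in bfs_edges v0 le q by rewrite mem_bfs_edges.
  by case: (bfs_edges v0 le q) => //= f s _; rewrite mem_head.
split=> //.
have [e eG qe] : exists2 e, e \in edges G & q e = v0.
  have [n] := ubnP (h v); elim: n v vv0 {aG} => // n IH v vv0 lt.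
  have [aG _ _] := a1 v vv0; have [E|ne] := eqVneq (q (a v)) v0; first by exists (a v).
  by apply: IH ne _; rewrite -ltnS -h1.
apply: le_anti; rewrite (bfs_root bfs rG) andbT -qe.
exact: (bfs_parent_mono bfs rG e0G eG (first_childP _ k2 unif rG e0G)
   (first_childP _ k2 unif rG eG) (lee_min eG)).
Qed.

(* The first BFS edge plays the role of the parent edge of the root. *)
Definition up v := if v == v0 then e0 else a v.
Definition down v := [set e in edges G | (q e == v) && (e != e0)].

Lemma mem_up u v : u != v0 -> up v \in edges G /\ v \in up v.
Proof.
move=> uv0; have [e0G qe0] := first_edge uv0; case: (rG) => q1 a1 _ _ _.
rewrite /up; case: eqVneq => [->|/a1[]//]; split=> //.
by rewrite -qe0 q1.
Qed.

Lemma edges_at u v : u != v0 ->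
  [set e in edges G | v \in e] = up v |: down v /\ up v \notin down v.
Proof.
move=> uv0; have [e0G qe0] := first_edge uv0; case: (rG) => q1 a1 a2 _ _.
have [upG vup] := mem_up v uv0.
split; last first.
  rewrite inE upG /= negb_and negbK /up; case: (eqVneq v v0) => [_|vv0].
    by rewrite eqxx orbT.
  by have [_ _ ->] := a1 v vv0.
apply/setP => e; rewrite !inE; apply/andP/orP => [[eG ve]|[/eqP->//|]]; last first.
  by move=> /and3P[eG /eqP qe _]; split; rewrite // -qe q1.
have [qe|qe] := eqVneq (q e) v; last first.
  have [vv0 av] := a2 e eG v ve qe.
  by left; rewrite /up (negPf vv0) av.
have [eE|ne] := eqVneq e e0; last by right; rewrite eG.
by left; rewrite /up -qe eE qe0 eqxx.
Qed.

Lemma degree_down u v : u != v0 -> degree v = (#|down v|).+1.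
Proof.
move=> uv0; have [E upn] := edges_at v uv0.
by rewrite -[degree v]cardsE E cardsU1 upn.
Qed.

Lemma sum_down u v : u != v0 ->
  \sum_(e in edges G | v \in e) edge_weight y e =
  edge_weight y (up v) + \sum_(e in down v) edge_weight y e.
Proof.
move=> uv0; have [E upn] := edges_at v uv0.
transitivity (\sum_(e in [set e in edges G | v \in e]) edge_weight y e).
  by apply: eq_bigl => e; rewrite inE.
by rewrite E big_setU1.
Qed.

Lemma mem_up_children v : v != v0 -> v \in ch (up v).
Proof.
move=> vv0; case: (rG) => _ a1 _ _ _; have [_ va qa] := a1 v vv0.
by rewrite /up (negPf vv0) mem_childrenE !inE va eq_sym qa.
Qed.

Lemma up_mono u v : le u v -> u != v -> lee (up u) (up v).
Proof.
move=> uv nuv; have vv0 : v != v0.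
  apply: contraNneq nuv => vE; apply/eqP/le_anti.
  by rewrite uv vE (bfs_root bfs rG).
have [upG _] := mem_up v vv0; have [upuG _] := mem_up u vv0.
have [uE|uv0] := eqVneq u v0; first by rewrite {1}/up uE eqxx; exact: lee_min.
have /orP[//|vu] := lee_total (up u) (up v).
have [->|ne] := eqVneq (up v) (up u); first exact: (wo_refl wo).
have /allrelP := bfs_children_before k2 unif bfs rG upG upuG ne vu.
move=> /(_ v u (mem_up_children vv0) (mem_up_children uv0)) vu'.
by case/eqP: nuv; apply: le_anti; rewrite uv.
Qed.

Lemma down_mono u v : le u v -> u != v ->
  {in down u & down v, forall e f, lee e f}.
Proof.
move=> uv nuv e f; rewrite !inE => /and3P[eG /eqP qe _] /and3P[fG /eqP qf _].
have /orP[//|fe] := lee_total e f.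
have := bfs_parent_mono bfs rG fG eG (first_childP _ k2 unif rG fG)
  (first_childP _ k2 unif rG eG) fe.
by rewrite qe qf => vu; case/eqP: nuv; apply: le_anti; rewrite uv.
Qed.

(* A later vertex has a smaller degree and lighter edges; equal weights and the
   eigenvalue equation force equality throughout. *)
Lemma class_edges u v : u != v -> y u = y v ->
  [/\ edge_type y (up u) = edge_type y (up v), #|down u| = #|down v| &
      {in down u & down v, forall e f, edge_type y e = edge_type y f}].
Proof.
wlog uv : u v / le u v => [W|] nuv yuv.
  have /orP[uv|vu] := le_total u v; first exact: W.
  have [||e1 e2 e3] := W v u vu; rewrite // 1?eq_sym //.
  by split=> // e f eu fv; rewrite (e3 f e).
have vv0 : v != v0.
  apply: contraNneq nuv => vE; apply/eqP/le_anti.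
  by rewrite uv vE (bfs_root bfs rG).
have [alpha0 alpha1] := andP alpha01; have beta0 : 0 < 1 - alpha by rewrite subr_gt0.
have downG w e : e \in down w -> e \in edges G by rewrite inE => /and3P[].
have [upuG _] := mem_up u vv0; have [upvG _] := mem_up v vv0.
have W0 e : 0 < edge_weight y e by apply: prodr_gt0.
have duv := bfs_degree bfs uv; rewrite !(degree_down _ vv0) ltnS in duv.
have [le1 eq1] := lee_weight upuG upvG (up_mono uv nuv).
have dom : {in down u & down v, forall e f, edge_weight y f <= edge_weight y e}.
  move=> e f eu fv.
  by have [] := lee_weight (downG _ _ eu) (downG _ _ fv) (down_mono uv nuv eu fv).
have [le2 eq2] := sum_dominated W0 duv dom.
have := y_eig u; have := y_eig v; rewrite !(sum_down _ vv0) !(degree_down _ vv0) yuv.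
set Su := \sum_(e in down u) _ in le2 eq2 *.
set Sv := \sum_(e in down v) _ in le2 eq2 *.
set Wu := edge_weight y (up u) in le1 eq1 *.
set Wv := edge_weight y (up v) in le1 eq1 *.
set c := y v ^+ k => Ev Eu.
have c0 : 0 <= c by rewrite exprn_ge0 // ltW.
(* The difference of the two eigenvalue equations. As [y u = y v], the terms with [rho] cancel, and
   each remaining summand is nonnegative because [u] precedes [v]. *)
have key : alpha * ((#|down u|)%:R - (#|down v|)%:R) * c +
    (1 - alpha) * ((Wu - Wv) + (Su - Sv)) = 0.
  have -> : (1 - alpha) * (Wu - Wv + (Su - Sv)) = (1 - alpha) * (Wu + Su) -
    (1 - alpha) * (Wv + Sv) by ring.
  by rewrite -Ev -Eu -!natr1; ring.
move/eqP: key; rewrite paddr_eq0; last 2 first.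
- by rewrite !mulr_ge0 // subr_ge0 ler_nat.
- by rewrite mulr_ge0 ?(ltW beta0) // addr_ge0 // subr_ge0.
case/andP=> _; rewrite mulf_eq0 (gt_eqF beta0) /= paddr_eq0 ?subr_ge0 //.
rewrite !subr_eq0 => /andP[/eqP e1 /eqP e2].
have [card same] := eq2 (esym e2).
split=> [|//|e f eu fv]; first by rewrite eq1.
have [_ eqt] := lee_weight (downG _ _ eu) (downG _ _ fv) (down_mono uv nuv eu fv).
by rewrite eqt //; apply/esym/same.
Qed.


Lemma bfs_parent_le e v : e \in edges G -> v \in e -> le (q e) v.
Proof.
move=> eG ve; have [->|vq] := eqVneq v (q e); first exact: (wo_refl wo).
apply: (lt_height_le bfs rG); rewrite (rooted_child rG eG ve) //.
by rewrite eq_sym.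
Qed.

Lemma type_count_down u v t : u != v0 ->
  type_count y v t =
  ((edge_type y (up v) == t) + #|[set e in down v | edge_type y e == t]|)%N.
Proof.
move=> uv0; have [E upn] := edges_at v uv0.
rewrite /type_count (_ : [set e in edges G | _] =
  [set e in up v |: down v | edge_type y e == t]); last first.
  by apply/setP => e; rewrite -E !inE andbA.
have countE (A : {set {set G}}) : #|[set e in A | edge_type y e == t]| =
    (\sum_(e in A) (edge_type y e == t))%N.
  rewrite -sum1dep_card big_mkcondr; apply: eq_bigr => e _.
  by case: (edge_type y e == t).
by rewrite !countE big_setU1.
Qed.

(** In a class with at least two vertices, each vertex has one edge of the type of [up v] and [r]
    further edges of a single type. If [r = 0], the edge [up v] stands in for [e]. *)
Lemma class_types u v : u != v -> y u = y v -> exists e r,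
  [/\ e \in edges G, r = #|down v| &
      forall w t, y w = y v -> type_count y w t =
        ((edge_type y (up v) == t) + r * (edge_type y e == t))%N /\
        {in down w, forall f, edge_type y f = edge_type y e}].
Proof.
move=> nuv yuv.
have [z zv0] : exists z, z != v0.
  have [uE|] := eqVneq u v0; last by exists u.
  by exists v; rewrite -uE eq_sym.
have [upG _] := mem_up v zv0.
have downG w e : e \in down w -> e \in edges G by rewrite inE => /and3P[].
have sameup w : y w = y v -> edge_type y (up w) = edge_type y (up v) /\ #|down w| = #|down v|.
  move=> yw; have [->//|nwv] := eqVneq w v.
  by have [] := class_edges nwv yw.
have count w e t : {in down w, forall f, edge_type y f = edge_type y e} ->
    #|[set f in down w | edge_type y f == t]| = (#|down w| * (edge_type y e == t))%N.
  move=> same; case: eqP => [<-|ne].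
    rewrite muln1; apply: eq_card => f; rewrite [LHS]inE.
    by case: (boolP (f \in down w)) => //= /same ->; exact: eqxx.
  rewrite muln0; apply: eq_card0 => f; rewrite [LHS]inE; apply/negP => /andP[fw /eqP ft].
  by apply: ne; rewrite -ft same.
have [d0|[e ev]] := set_0Vmem (down v).
  exists (up v), #|down v|; split=> // w t yw; have [uptw dw] := sameup w yw.
  have dw0 : down w = set0 by apply: cards0_eq; rewrite dw d0 cards0.
  have same : {in down w, forall f, edge_type y f = edge_type y (up v)}.
    by move=> f; rewrite dw0 inE.
  by rewrite (type_count_down _ _ zv0) (count _ _ _ same) dw uptw.
exists e, #|down v|; split=> // [|w t yw]; first exact: downG ev.
have [uptw dw] := sameup w yw.
have same : {in down w, forall f, edge_type y f = edge_type y e}.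
  move=> f fw; have [wv|nwv] := eqVneq w v; last first.
    by have [_ _ same] := class_edges nwv yw; exact: same.
  (* [class_edges] compares distinct vertices only, so two edges of [down v] are compared through an
     edge of [down u]. *)
  have [_ du same] := class_edges nuv yuv.
  have /card_gt0P[g gu] : (0 < #|down u|)%N.
    by rewrite du; apply/card_gt0P; exists e.
  by rewrite wv in fw; rewrite -(same g f gu fw) (same g e gu ev).
by rewrite (type_count_down _ _ zv0) (count _ _ _ same) dw uptw.
Qed.

(** * Transfer of the multiplicities to the other supertree *)

Section LocalCount.
Variable H : hypergraph.
Variables (w0 : H) (p : {set H} -> H) (b : H -> {set H}) (g : H -> nat).
Hypothesis rH : rooted w0 p b g.
Variable x : H -> R.
Hypothesis x_eig : forall v, (rho - alpha * (degree v)%:R) * x v ^+ k =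
  (1 - alpha) * \sum_(e in edges H | v \in e) edge_weight x e.
Hypothesis x_parent :
  {in edges H, forall e : {set H}, {in e, forall v, x v <= x (p e)}}.
Hypothesis same_types : forall t,
  #|[set e in edges H | edge_type x e == t]| = #|[set e in edges G | edge_type y e == t]|.
Hypothesis same_classes : forall c : R, #|[pred v | x v == c]| = #|[pred v | y v == c]|.

Lemma sum_same_count c t :
  (\sum_(v | x v == c) type_count x v t = \sum_(v | y v == c) type_count y v t)%N.
Proof. by rewrite !sum_type_count same_types. Qed.

(* In the eigenvalue equation at a vertex all but one of the edge types occur a
   known number of times, so the equation determines the remaining multiplicity. *)
Lemma eig_mult (c W D : R) (d m n : nat) : 0 < c -> 0 < W ->
  (rho - alpha * (d + m)%:R) * c = (1 - alpha) * (D + W *+ m) ->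
  (rho - alpha * (d + n)%:R) * c = (1 - alpha) * (D + W *+ n) -> m = n.
Proof.
move=> c0 W0 Em En; have [alpha0 alpha1] := andP alpha01.
have beta0 : 0 < 1 - alpha by rewrite subr_gt0.
have : (m%:R - n%:R) * (alpha * c + (1 - alpha) * W) = 0.
  have -> : (m%:R - n%:R) * (alpha * c + (1 - alpha) * W) =
    ((rho - alpha * (d + n)%:R) * c - (1 - alpha) * (D + W *+ n)) -
    ((rho - alpha * (d + m)%:R) * c - (1 - alpha) * (D + W *+ m)).
    by rewrite -!(mulr_natr W) !natrD; ring.
  by rewrite Em En !subrr.
have pos : 0 < alpha * c + (1 - alpha) * W.
  by apply: ltr_wpDl; [rewrite mulr_ge0 // ltW | rewrite mulr_gt0].
by move/eqP; rewrite mulf_eq0 subr_eq0 eqr_nat (gt_eqF pos) orbF => /eqP.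
Qed.

(* If the largest entry of [t] exceeds [x v], then [v] is not the top of an edge of
   type [t]; otherwise only the first BFS edge of [G] can have type [t]. *)
Lemma head_type_le_one (v : H) (v' : G) t (e : {set G}) : x v = y v' -> t != edge_type y e ->
  (forall w, y w = y v' -> {in down w, forall f, edge_type y f = edge_type y e}) ->
  (type_count x v t <= 1)%N.
Proof.
move=> xy nte same; case: (rH) => p1 _ b2 _ _; case: (rG) => q1 _ _ _ _.
have [hd|hd] := eqVneq (head 0 t) (x v); last first.
  rewrite -(cards1 (b v)) subset_leq_card //; apply/subsetP => f.
  rewrite !inE => /and3P[fH vf /eqP ft]; apply/eqP.
  have pv : p f != v.
    apply: contraNneq hd => <-; rewrite -ft; apply/eqP.
    by apply: head_edge_type; [exact: p1 | exact: x_parent].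
  by have [_ ->] := b2 f fH v vf pv.
have sub : [set f in edges G | edge_type y f == t] \subset [set e0].
  apply/subsetP => f; rewrite !inE => /andP[fG /eqP ft].
  have yq : y (q f) = y v'.
    rewrite -xy -hd -ft; apply/esym/head_edge_type; first exact: q1.
    by move=> w wf; apply/y_anti/bfs_parent_le.
  apply: contraNT nte => fe0; rewrite -ft; apply/eqP/(same _ yq).
  by rewrite inE fG fe0 eqxx.
have := subset_leq_card sub; rewrite cards1 -same_types; apply: leq_trans.
by apply/subset_leq_card/subsetP => f; rewrite !inE => /and3P[-> _ ->].
Qed.

(** The sums over a weight class settle a class with one vertex, and show that types absent in [G]
    are absent in [H]. In a larger class at most two types remain, [t0] above and [tq] below; once
    [t0] is counted, the eigenvalue equation gives the multiplicity of [tq]. *)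
Lemma local_count v v' t : x v = y v' -> type_count x v t = type_count y v' t.
Proof.
move=> xy; pose c := y v'.
have [N1|/forallPn[u']] :=
    boolP [forall u' : G, (y u' == c) ==> (u' == v')]; last first.
  rewrite negb_imply => /andP[/eqP yu' nuv'].
  have [e [r [eG rE cls]]] := class_types nuv' yu'.
  pose t0 := edge_type y (up v'); pose tq := edge_type y e.
  have cGE w t' : y w = y v' -> type_count y w t' = ((t0 == t') + r * (tq == t'))%N.
    by move=> yw; have [] := cls w t' yw.
  have same w : y w = y v' -> {in down w, forall f, edge_type y f = tq}.
    by move=> yw; have [] := cls w t0 yw.
  have zeroG t' : t' \notin [:: t0; tq] -> type_count y v' t' = 0%N.
    rewrite !inE negb_or cGE // => /andP[n1 n2].
    by rewrite [t0 == _]eq_sym [tq == _]eq_sym (negPf n1) (negPf n2) muln0.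
  have zeroH t' : t' \notin [:: t0; tq] -> type_count x v t' = 0%N.
    move=> t'n; have : (\sum_(w | x w == c) type_count x w t' == 0)%N.
      rewrite sum_same_count big1 // => w /eqP yw.
      by rewrite cGE // -(cGE v') // zeroG.
    by rewrite sum_nat_eq0 => /forallP/(_ v)/implyP; rewrite xy eqxx => /(_ isT)/eqP.
  pose ts := undup [:: t0; tq].
  have ts_uniq : uniq ts by exact: undup_uniq.
  have tsH f : f \in edges H -> v \in f -> edge_type x f \in ts.
    move=> fH vf; rewrite mem_undup; apply/negPn/negP => /zeroH/eqP.
    by rewrite cards_eq0 => /eqP/setP/(_ f); rewrite !inE fH vf eqxx.
  have tsG f : f \in edges G -> v' \in f -> edge_type y f \in ts.
    move=> fG vf; rewrite mem_undup; apply/negPn/negP => /zeroG/eqP.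
    by rewrite cards_eq0 => /eqP/setP/(_ f); rewrite !inE fG vf eqxx.
  have EH := x_eig v; have EG := y_eig v'.
  rewrite (degree_type ts_uniq tsH) (sum_weight_type ts_uniq tsH) xy in EH.
  rewrite (degree_type ts_uniq tsG) (sum_weight_type ts_uniq tsG) in EG.
  have ck0 : 0 < y v' ^+ k by exact: exprn_gt0.
  have Wq0 : 0 < \prod_(z <- tq) z by rewrite -edge_weight_type; apply: prodr_gt0.
  have [t0q|t0q] := eqVneq t0 tq.
    have tsE : ts = [:: tq] by rewrite /ts /= inE t0q eqxx.
    rewrite tsE !big_seq1 in EH; rewrite tsE !big_seq1 in EG.
    have E : type_count x v tq = type_count y v' tq.
      by apply: (@eig_mult _ _ 0 0%N _ _ ck0 Wq0); rewrite add0r.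
    have [->//|ntq] := eqVneq t tq.
    by rewrite zeroG ?zeroH // !inE t0q negb_or ntq.
  have tsE : ts = [:: t0; tq] by rewrite /ts /= inE (negPf t0q).
  have one_le w : x w = c -> (type_count x w t0 <= 1)%N.
    by move=> xw; apply: (head_type_le_one (v' := v') xw t0q).
  have oneG w : y w = y v' -> type_count y w t0 = 1%N.
    by move=> yw; rewrite cGE // eqxx [tq == _]eq_sym (negPf t0q) muln0.
  (* Each vertex of the class in [H] has at most one edge of type [t0], and the total equals the
     size of the class. *)
  have oneH : type_count x v t0 = 1%N.
    have : (\sum_(w | x w == c) (1 - type_count x w t0) == 0)%N.
      rewrite sumnB => [|w /eqP/one_le//].
      have E1 : (\sum_(w | y w == c) type_count y w t0 = \sum_(w | y w == c) 1)%N.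
        by apply: eq_bigr => w /eqP/oneG.
      by rewrite sum_same_count E1 !sum1_card same_classes subnn.
    rewrite sum_nat_eq0 => /forallP/(_ v)/implyP; rewrite xy eqxx => /(_ isT).
    by rewrite subn_eq0 => ge1; apply/eqP; rewrite eqn_leq ge1 one_le.
  rewrite tsE !big_cons !big_nil oneH addn0 addr0 mulr1n in EH.
  rewrite tsE !big_cons !big_nil oneG // addn0 addr0 mulr1n in EG.
  have E := eig_mult ck0 Wq0 EH EG.
  have [->|nt0] := eqVneq t t0; first by rewrite oneH oneG.
  have [->//|ntq] := eqVneq t tq.
  by rewrite zeroG ?zeroH // !inE negb_or nt0 ntq.
have cG : #|[pred u | y u == c]| = 1%N.
  rewrite -(card1 v'); apply: eq_card => u; rewrite !inE.
  by apply/idP/idP => [yu|/eqP->//]; have /forallP/(_ u)/implyP := N1; apply.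
have cH := same_classes c; rewrite cG in cH.
have onlyH u : (x u == c) = (u == v).
  have [z zE] := mem_card1 cH.
  have /eqP vz : v == z by have := zE v; rewrite !inE xy eqxx.
  by have := zE u; rewrite !inE vz.
have onlyG u : (y u == c) = (u == v').
  by apply/idP/eqP => [yu|->]; [apply/eqP; have /forallP/(_ u)/implyP := N1; apply | exact: eqxx].
have := sum_same_count c t.
by rewrite (eq_bigl _ _ onlyH) (eq_bigl _ _ onlyG) !big_pred1_eq.
Qed.

End LocalCount.
End ClassesBFS.

(** * Isomorphism from local data *)

(** The empty list is set apart because [B] may then be empty and admit no function from [A]. *)
Lemma matching_of_perm (A B : finType) (T : eqType) (x : A -> T) (y : B -> T)
    (s : seq A) (s' : seq B) : uniq s -> perm_eq (map x s) (map y s') ->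
  s = [::] \/ exists g : A -> B, {in s, forall v, y (g v) = x v} /\ perm_eq (map g s) s'.
Proof.
elim: s s' => [|v s IH] s' /=; first by left.
case/andP=> vs us p; right.
have : x v \in map y s' by rewrite -(perm_mem p) mem_head.
case/mapP=> w ws' xy.
have p' : perm_eq (map x s) (map y (rem w s')).
  by rewrite -(perm_cons (x v)) (permPl p) xy (perm_map y (perm_to_rem ws')).
have [g [gxy gs]] : exists g : A -> B,
    {in s, forall v, y (g v) = x v} /\ perm_eq (map g s) (rem w s').
  case: (IH _ us p') => // s0; exists (fun=> w); split; first by rewrite s0.
  by have := perm_size p'; rewrite s0 !size_map => /esym/size0nil ->.
exists (fun u => if u == v then w else g u); split.
  move=> u; rewrite inE; case: (eqVneq u v) => [->|_ /= us']; first by rewrite xy.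
  exact: gxy.
rewrite eqxx (permPr (perm_to_rem ws')) perm_cons -(permPr gs).
rewrite (eq_in_map _ g s).1 // => u us'.
by case: eqVneq => // uv; rewrite -uv us' in vs.
Qed.

Section Isomorphism.
Variables (R : realType) (k : nat) (G H : hypergraph).
Variables (x : H -> R) (y : G -> R).
Hypotheses (k2 : (2 <= k)%N) (sG : supertree k G) (sH : supertree k H).
Hypothesis counts : forall v v' t, x v = y v' -> type_count x v t = type_count y v' t.

Lemma edge_type_imset (f : H -> G) (S e : {set H}) :
  {in S &, injective f} -> {in S, forall v, y (f v) = x v} -> e \subset S ->
  edge_type y (f @: e) = edge_type x e.
Proof.
move=> inj fxy /subsetP eS; apply: edge_type_eq.
have pe : perm_eq (enum (f @: e)) (map f (enum e)).
  apply: uniq_perm; first exact: enum_uniq.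
    rewrite map_inj_in_uniq ?enum_uniq // => u v; rewrite !mem_enum => /eS uS /eS vS.
    exact: inj.
  move=> w; rewrite mem_enum; apply/imsetP/mapP => -[u ue ->]; exists u => //.
    by rewrite mem_enum.
  by rewrite mem_enum in ue.
rewrite -(permPr (permEl (perm_sort >=%R _))).
rewrite (permPl (perm_map y pe)) -map_comp perm_sym perm_sort.
suff -> : map (y \o f) (enum e) = map x (enum e) by [].
by apply/eq_in_map => v; rewrite mem_enum => /eS/fxy.
Qed.

Lemma grown_image (v0 : H) (v0' : G) S W : x v0 = y v0' -> grown v0 S W ->
  exists f : H -> G, [/\ {in S &, injective f}, {in S, forall v, y (f v) = x v} &
    grown v0' (f @: S) [set f @: (e : {set H}) | e in W]].
Proof.
move=> xy gr; case: (sG) => unifG _ acyG; case: (sH) => unifH _ acyH.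
elim: gr => [|{}S {}W e w gr [f [inj fxy grf]] eH eW wS we].
  exists (fun=> v0'); split.
  - by move=> u v; rewrite !inE => /eqP-> /eqP->.
  - by move=> v; rewrite inE => /eqP->.
  - by rewrite imset_set1 imset0; exact: Grown0.
have WS e1 : e1 \in W -> e1 \subset S by exact: (grown_sub gr).
pose t := edge_type x e.
pose A := [set e1 in W | (w \in e1) && (edge_type x e1 == t)].
have ltA : (#|A| < type_count y (f w) t)%N.
  rewrite -(counts _ (esym (fxy w wS))) /type_count.
  apply: proper_card; apply/properP; split.
    apply/subsetP => e1; rewrite !inE => /andP[e1W ->].
    by rewrite (subsetP (grown_edges gr)).
  by exists e; rewrite !inE ?eH ?we ?eqxx // (negPf eW).
have [e'] : exists e', e' \in [set e1 in edges G | (f w \in e1) && (edge_type y e1 == t)]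
    :\: [set f @: (e1 : {set H}) | e1 in A].
  apply/set0Pn; rewrite -card_gt0 cardsD subn_gt0.
  apply: leq_ltn_trans ltA; apply: leq_trans (leq_imset_card _ _).
  exact/subset_leq_card/subsetIr.
rewrite !inE => /and3P[e'A e'G /andP[we' /eqP e't]].
(* An image edge of this type through [f w] comes from an edge of [A], by injectivity of [f] on
   [S]. *)
have e'W : e' \notin [set f @: (e1 : {set H}) | e1 in W].
  apply: contra e'A => /imsetP[e1 e1W e'E]; rewrite e'E; apply: imset_f.
  rewrite inE e1W /=; apply/andP; split.
    move: we'; rewrite e'E => /imsetP[u ue1 fwu].
    by rewrite (inj w u wS (subsetP (WS e1 e1W) u ue1) fwu).
  by rewrite -(edge_type_imset inj fxy (WS e1 e1W)) -e'E e't.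
have meetH u : u \in S -> u \in e -> u = w.
  by move=> uS ue; apply: (grown_meet acyH gr eH eW); rewrite inE ?uS ?wS.
have meetG u : u \in f @: S -> u \in e' -> u = f w.
  by move=> uS ue; apply: (grown_meet acyG grf e'G e'W); rewrite inE ?uS ?imset_f.
have : perm_eq (map x (enum (e :\ w))) (map y (enum (e' :\ f w))).
  have split1 (K : hypergraph) (z : K -> R) (d : {set K}) u : u \in d ->
      perm_eq (edge_type z d) (z u :: map z (enum (d :\ u))).
    move=> ud; rewrite perm_sort -map_cons; apply: perm_map; apply: uniq_perm.
    - exact: enum_uniq.
    - by rewrite /= enum_uniq mem_enum !inE eqxx.
    - by move=> z'; rewrite inE !mem_enum !inE; case: eqVneq => [->|].
  rewrite -(perm_cons (x w)) -(permPl (split1 _ x e w we)) -(fxy w wS).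
  by rewrite -(permPr (split1 _ y e' (f w) we')) -/t e't.
case/(matching_of_perm (enum_uniq _)) => [e0|[g [gxy gs]]].
  have := cardsD1 w e; rewrite we unifH // [#|e :\ w|]cardE e0 => k1.
  by move: k2; rewrite k1.
pose f' v := if v \in S then f v else g v.
have f'S v : v \in S -> f' v = f v by rewrite /f' => ->.
have ge v : v \in e -> v \notin S -> [/\ v \in enum (e :\ w), g v \in e' & g v != f w].
  move=> ve vS; have vew : v \in enum (e :\ w).
    by rewrite mem_enum !inE ve andbT; apply: contraNneq vS => ->.
  have : g v \in enum (e' :\ f w) by rewrite -(perm_mem gs) map_f.
  by rewrite mem_enum !inE => /andP[].
have f'e : f' @: e = e'.
  apply/setP => z; apply/imsetP/idP => [[u ue ->]|ze'].
    rewrite /f'; case: ifP => [uS|/negbT uS]; first by rewrite (meetH u uS ue).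
    by have [] := ge u ue uS.
  have [->|zw] := eqVneq z (f w); first by exists w; rewrite // f'S.
  have : z \in map g (enum (e :\ w)) by rewrite (perm_mem gs) mem_enum !inE zw.
  case/mapP=> u; rewrite mem_enum !inE => /andP[uw ue] ->; exists u => //.
  by rewrite /f'; case: ifP => // uS; rewrite (meetH u uS ue) eqxx in uw.
exists f'; split.
- have cross u v : u \in S -> v \in e -> v \notin S -> f u <> g v.
    move=> uS ve vS fug; have [_ gve gvw] := ge v ve vS.
    by case/eqP: gvw; apply: meetG => //; rewrite -fug imset_f.
  move=> u v; rewrite /f' !inE.
  case: (boolP (u \in S)) => uS; case: (boolP (v \in S)) => vS //=.
  + by move=> _ _; exact: inj.
  + by move=> _ ve /(cross u v uS ve vS).
  + by move=> ue _ /esym/(cross v u vS ue uS).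
  move=> ue ve guv; have [uew _ _] := ge u ue uS; have [vew _ _] := ge v ve vS.
  have ug : uniq (map g (enum (e :\ w))) by rewrite (perm_uniq gs) enum_uniq.
  have := nth_uniq (g u) (s := map g (enum (e :\ w))) (i := index u (enum (e :\ w)))
    (j := index v (enum (e :\ w))).
  rewrite !size_map !index_mem uew vew ug => /(_ isT isT isT).
  rewrite !(nth_map u) ?index_mem // !nth_index // guv eqxx => /esym/eqP ij.
  by rewrite -(nth_index u uew) ij nth_index.
- move=> v; rewrite /f' !inE; case: (boolP (v \in S)) => [vS _|vS /= ve]; first exact: fxy.
  by have [vew _ _] := ge v ve vS; apply: gxy.
- have -> : f' @: (S :|: e) = f @: S :|: e'.
    rewrite imsetU f'e; congr (_ :|: _); apply: eq_in_imset => v; exact: f'S.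
  have -> : [set f' @: (e1 : {set H}) | e1 in e |: W] =
      e' |: [set f @: (e1 : {set H}) | e1 in W].
    rewrite imsetU1 f'e; congr (_ |: _); apply: eq_in_imset => e1 e1W.
    apply: eq_in_imset => v ve1; apply: f'S; exact: (subsetP (WS e1 e1W)).
  exact: GrownS grf e'G e'W (imset_f f wS) we'.
Qed.

(** The embedding is bijective by cardinality. An edge of [G] outside the image would have two
    vertices in common with the grown subtree, which contains all vertices, against [grown_meet]. *)
Lemma isomorphic_of_counts (v0 : H) (v0' : G) : x v0 = y v0' -> #|G| = #|H| ->
  isomorphic H G.
Proof.
move=> xy card; case: (sG) => unifG _ acyG.
have [f [inj fxy grf]] := grown_image xy (grown_total v0 k2 sH).
have finj : injective f by move=> u v; apply: inj.
have fbij : bijective f by apply: inj_card_bij; rewrite // card.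
have fT : f @: [set: H] = setT.
  by apply/eqP; rewrite eqEcard subsetT /= !cardsT card_imset // cardsT card.
have We : [set f @: (e : {set H}) | e in edges H] = edges G.
  apply/eqP; rewrite eqEsubset (grown_edges grf) /=; apply/subsetP => e eG.
  apply/negPn/negP => eW; have := unifG e eG => ek.
  have /card_gt1P[u [v [ue ve]]] : (1 < #|e|)%N by rewrite ek.
  by case/eqP; apply: (grown_meet acyG grf eG eW); rewrite fT inE in_setT.
exists f; split=> // e; rewrite -We; apply/imsetP/idP => [[e1 e1H /(imset_inj finj)->]//|eH].
by exists e.
Qed.

End Isomorphism.

(** * The canonical BFS-supertree *)

Section Canonical.
Local Open Scope nat_scope.
Variables (n m : nat) (pi : seq nat).
Hypotheses (n_gt0 : 0 < n) (pi_sorted : sorted geq pi).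
Hypotheses (pi_size : size pi = (m * n).+1) (pi_sum : sumn pi = m * n + m).
Hypothesis pi_pos : 0 < m -> all (leq 1) pi.

Lemma pi_anti i j : i <= j -> nth 0 pi j <= nth 0 pi i.
Proof.
move=> ij; have [jlt|jge] := ltnP j (size pi); last by rewrite nth_default.
have gt : transitive geq by move=> y x z /= yx zy; exact: leq_trans zy yx.
exact: (sorted_leq_nth gt leqnn 0 pi_sorted i j (leq_ltn_trans ij jlt) jlt ij).
Qed.

Lemma sumn_le c s : all (fun x => x <= c) s -> sumn s <= c * size s.
Proof. by elim: s => //= x s IH /andP[xc /IH]; rewrite mulnS; apply: leq_add. Qed.

Lemma sumn_ge c s : all (leq c) s -> c * size s <= sumn s.
Proof.
elim: s => [|x s IH] /=; rewrite ?muln0 // => /andP[xc /IH].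
by rewrite mulnS; apply: leq_add.
Qed.

(* The first [j * n + 1] degrees leave room for more than [j] child edges, since
   either all of them are at least 2 or all the remaining ones are at most 1. *)
Lemma sumn_take_pi j : j < m -> j * n + j < sumn (take (j * n).+1 pi).
Proof.
move=> jm; have jnm : j * n < m * n by rewrite ltn_pmul2r.
have tot : sumn (take (j * n).+1 pi) + sumn (drop (j * n).+1 pi) = m * n + m.
  by rewrite -sumn_cat cat_take_drop.
have [le1|ge2] := leqP (nth 0 pi (j * n).+1) 1.
  have : sumn (drop (j * n).+1 pi) <= 1 * size (drop (j * n).+1 pi).
    apply: sumn_le; apply/(all_nthP 0) => i _; rewrite nth_drop.
    by rewrite (leq_trans _ le1) // pi_anti // leq_addr.
  by rewrite mul1n size_drop pi_size subSS; lia.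
have : 2 * size (take (j * n).+1 pi) <= sumn (take (j * n).+1 pi).
  apply: sumn_ge; apply/(all_nthP 0) => i; rewrite size_takel; last by rewrite pi_size ltnS ltnW.
  move=> ilt; rewrite nth_take // (leq_trans ge2) // pi_anti //.
  exact: ltnW.
rewrite size_takel; last by rewrite pi_size ltnS ltnW.
have : j * 1 <= j * n by rewrite leq_mul2l n_gt0 orbT.
lia.
Qed.

(* The truncated subtraction of a boolean accounts for the edge above [i], absent
   at the root. *)
Definition child_count i := nth 0 pi i - (i != 0).

(** Vertex [i] is listed once for each edge below it. In the application [n] is [k - 1] and [m] the
    number of edges, so [pi_sum] is the degree sum [m * k]. *)
Definition parents := flatten [seq nseq (child_count i) i | i <- iota 0 (size pi)].

Lemma count_parents_lt c : c < size pi ->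
  count (fun i => i <= c) parents + c = sumn (take c.+1 pi).
Proof.
move=> clt; rewrite count_flatten -map_comp sumnE big_map.
rewrite (eq_bigr (fun i => (i <= c) * child_count i)) => [|i _]; last first.
  by rewrite /= count_nseq.
rewrite -(subnKC clt) iotaD big_cat /= [X in _ + X + _]big1_seq ?addn0; last first.
  by move=> i /andP[_]; rewrite mem_iota => /andP[ci _]; rewrite leqNgt ci.
rewrite (eq_big_seq child_count) => [|i]; last first.
  by move: (mem_iota 0 c.+1 i) => -> /=; rewrite add0n ltnS => ->; rewrite mul1n.
elim: c clt => [|c IH] clt.
  rewrite /= big_seq1 /child_count subn0 !addn0.
  by case: (pi) pi_size => //= x s _; rewrite take0 /= addn0.
have -> : 0 :: iota 1 c.+1 = (0 :: iota 1 c) ++ [:: c.+1].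
  by rewrite -[0 :: iota 1 c.+1]/(iota 0 c.+2) -(addn1 c.+1) iotaD.
rewrite big_cat /= big_seq1 (take_nth 0 clt) sumn_rcons -IH ?(ltnW clt) // /child_count.
have : 0 < nth 0 pi c.+1.
  have m0 : 0 < m by move: clt; rewrite pi_size ltnS; case: (m).
  exact: (allP (pi_pos m0)) (mem_nth 0 clt).
by set S := \sum_(_ <- _) _; rewrite /=; lia.
Qed.

Lemma count_parents_mem c : c < size pi -> count_mem c parents = child_count c.
Proof.
move=> clt; rewrite count_flatten -map_comp sumnE big_map.
rewrite (bigD1_seq c) ?iota_uniq ?mem_iota //= count_nseq /= eqxx mul1n.
rewrite big1 ?addn0 // => i ic; rewrite count_nseq /= (negPf ic) //.
Qed.

Lemma size_parents : size parents = m.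
Proof.
have := @count_parents_lt (m * n); rewrite pi_size ltnSn => /(_ isT).
rewrite -pi_size take_size pi_sum addnC => /addnI <-.
apply/esym/eqP; rewrite -all_count; apply/allP => x /flattenP[_ /mapP[i ilt ->]].
by move: ilt; rewrite mem_iota add0n pi_size ltnS mem_nseq => /= ilt /andP[_ /eqP->].
Qed.

Lemma parents_sorted : sorted leq parents.
Proof.
apply: (sorted_flatten leq_trans ltn_trans (iota_ltn_sorted 0 _) (iota_uniq _ _)).
- move=> i _; case: (child_count i) => //= c.
  by elim: c => //= c ->; rewrite leqnn.
- move=> i j _ _ _ ij; apply/allrelP => y z; rewrite !mem_nseq.
  by case/andP=> _ /eqP-> /andP[_ /eqP->]; exact: ltnW.
Qed.

(** More than [j] edges have their top among the vertices [0] to [j * n], so the edge [j] is one of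
    them: its top precedes its children. *)
Lemma parent_le j : j < m -> nth 0 parents j <= j * n.
Proof.
move=> jm; rewrite leqNgt; apply/negP => gt.
have jn : j * n < size pi by rewrite pi_size ltnS leq_mul2r ltnW ?orbT.
have := sumn_take_pi jm; rewrite -count_parents_lt // addnC ltn_add2r.
rewrite -{1}(cat_take_drop j parents) count_cat.
have -> : count (fun i => i <= j * n) (drop j parents) = 0.
  apply/eqP; rewrite -leqn0 leqNgt -has_count; apply/hasPn => x.
  case/(nthP 0) => i ilt <-; rewrite nth_drop -ltnNge (leq_trans gt) //.
  rewrite size_drop ltn_subRL in ilt.
  exact: (sorted_leq_nth leq_trans leqnn 0 parents_sorted j (j + i)
    (leq_ltn_trans (leq_addr i j) ilt) ilt (leq_addr i j)).
rewrite addn0 => /leq_trans/(_ (count_size _ _)).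
by rewrite size_takel ?ltnn // size_parents ltnW.
Qed.

Lemma parent_mono i j : i <= j -> j < m -> nth 0 parents i <= nth 0 parents j.
Proof.
move=> ij jm.
apply: (sorted_leq_nth leq_trans leqnn 0 parents_sorted) => //; rewrite inE size_parents //.
exact: leq_ltn_trans jm.
Qed.

Local Notation V := 'I_(m * n).+1.

(* The vertex [0] is the root, and [j * n + 1], ..., [j * n + n] are the children
   in the edge [j], whose top vertex is the [j]-th entry of [parents]. *)
Definition canonical_edge (j : nat) : {set V} :=
  inord (nth 0 parents j) |: [set inord (j * n + (r : 'I_n)).+1 | r : 'I_n].

Definition canonical := Hypergraph [set canonical_edge (j : 'I_m) | j : 'I_m].

Lemma child_lt j r : j < m -> r < n -> (j * n + r).+1 < (m * n).+1.
Proof.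
move=> jm rn; rewrite ltnS (@leq_trans (j.+1 * n)) ?leq_mul2r ?jm ?orbT //.
by rewrite mulSn addnC ltn_add2r.
Qed.

Lemma mem_canonical_edge (j : nat) (v : V) : j < m ->
  (v \in canonical_edge j) = (v == nth 0 parents j :> nat) || (0 < v) && (v.-1 %/ n == j).
Proof.
move=> jm; rewrite !inE; congr (_ || _).
  rewrite -val_eqE /= inordK // ltnS (leq_trans (parent_le jm)) //.
  by rewrite leq_mul2r ltnW ?orbT.
apply/imsetP/andP => [[r _ ->]|[v0 /eqP vj]].
  by rewrite inordK ?child_lt //= divnMDl // divn_small // addn0.
exists (Ordinal (ltn_pmod v.-1 n_gt0)) => //; apply/val_inj.
rewrite /= -vj -divn_eq prednK // inordK //.
Qed.

Lemma canonical_edgeP (e : {set canonical}) : e \in edges canonical ->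
  exists2 j, j < m & e = canonical_edge j.
Proof. by case/imsetP=> j _ ->; exists j. Qed.

Lemma canonical_edge_in j : j < m -> canonical_edge j \in edges canonical.
Proof. by move=> jm; apply/imsetP; exists (Ordinal jm). Qed.

(** The first child [j * n + 1] of the later edge is too large to be a child of the earlier one or,
    by [parent_le], its top. *)
Lemma canonical_edge_inj i j : i < m -> j < m ->
  canonical_edge i = canonical_edge j -> i = j.
Proof.
wlog ij : i j / i <= j => [W im jm E|im jm E].
  by have /orP[ij|ji] := leq_total i j; [exact: W | apply/esym/W].
apply/eqP; rewrite eqn_leq ij leqNgt; apply/negP => lt.
have jlt : (j * n).+1 < (m * n).+1 by rewrite ltnS ltn_mul2r n_gt0.
pose v : V := Ordinal jlt.
have : v \in canonical_edge j by rewrite mem_canonical_edge //= mulnK // eqxx orbT.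
rewrite -E mem_canonical_edge //= mulnK // (gtn_eqF lt) orbF => /eqP vE.
have := parent_le im; rewrite -vE ltnNge => /negP; apply.
by rewrite leq_mul2r ltnW ?orbT.
Qed.

Lemma edge_of_child (v : V) : 0 < v -> v.-1 %/ n < m.
Proof.
move=> v0; rewrite ltn_divLR // -ltnS prednK //; exact: ltn_ord.
Qed.


(** Edges are sets without an index, so the top is recovered as the least vertex; [ord0] is a
    default for the empty set. *)
Definition top_vertex (e : {set canonical}) : canonical :=
  odflt (ord0 : V) [pick v in e | [forall u in e, (v : V) <= (u : V)]].

Lemma parent_lt_size j : j < m -> nth 0 parents j < (m * n).+1.
Proof.
by move=> jm; rewrite ltnS (leq_trans (parent_le jm)) // leq_mul2r ltnW ?orbT.
Qed.

Lemma top_canonical_edge j : j < m -> (top_vertex (canonical_edge j) : V) = nth 0 parents j :> nat.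
Proof.
move=> jm; pose z : V := inord (nth 0 parents j).
have zE : z = nth 0 parents j :> nat by rewrite inordK ?parent_lt_size.
have ze : z \in canonical_edge j by rewrite mem_canonical_edge // zE eqxx.
have zmin (u : V) : u \in canonical_edge j -> z <= u.
  rewrite mem_canonical_edge // zE => /orP[/eqP->//|/andP[u0 /eqP uj]].
  rewrite (leq_trans (parent_le jm)) // -uj.
  by rewrite (leq_trans (leq_trunc_div _ _)) // leq_pred.
rewrite /top_vertex; case: pickP => [v /andP[ve /forallP vmin]|/(_ z)] /=.
  rewrite -zE; apply/eqP; rewrite eqn_leq zmin // andbT.
  by have /implyP := vmin z; apply.
rewrite ze /= => /forallP[] u; exact/implyP/zmin.
Qed.

Definition up_edge (v : canonical) : {set canonical} := canonical_edge ((v : V).-1 %/ n).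

(** Parents have smaller numbers by [parent_lt], so [v] itself is enough fuel. *)
Fixpoint depth_rec (fuel v : nat) : nat :=
  if fuel is f.+1 then
    if v == 0 then 0 else (depth_rec f (nth 0 parents (v.-1 %/ n))).+1
  else 0.

Definition depth v := depth_rec v v.

Lemma parent_lt v : 0 < v -> v < (m * n).+1 -> nth 0 parents (v.-1 %/ n) < v.
Proof.
move=> v0 vlt; have jm : v.-1 %/ n < m by rewrite ltn_divLR // -ltnS prednK.
by rewrite (leq_ltn_trans (parent_le jm)) // (leq_ltn_trans (leq_trunc_div _ _)) // prednK.
Qed.


Lemma depth_recE f g v : v < (m * n).+1 -> v <= f -> v <= g -> depth_rec f v = depth_rec g v.
Proof.
elim: f g v => [|f IH] [|g] v vlt //=; rewrite ?leqn0.
- by move=> /eqP->.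
- by move=> _ /eqP->.
move=> vf vg; case: eqVneq => // v0; congr _.+1.
have lt : nth 0 parents (v.-1 %/ n) < v by rewrite parent_lt // lt0n.
by apply: IH; [exact: ltn_trans vlt | rewrite -ltnS (leq_trans lt) | rewrite -ltnS (leq_trans lt)].
Qed.

Lemma depthE v : 0 < v -> v < (m * n).+1 ->
  depth v = (depth (nth 0 parents (v.-1 %/ n))).+1.
Proof.
move=> v0 vlt; have lt := parent_lt v0 vlt; rewrite /depth.
case: v v0 vlt lt => //= v _ vlt lt; congr _.+1; apply: depth_recE => //.
exact: ltn_trans vlt.
Qed.

Lemma depth_mono u v : u <= v -> v < (m * n).+1 -> depth u <= depth v.
Proof.
have [f] := ubnP v; elim: f u v => // f IH u v vf uv vlt.
case: (posnP u) => [->//|u0]; have v0 := leq_trans u0 uv.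
rewrite (depthE u0 (leq_ltn_trans uv vlt)) (depthE v0 vlt) ltnS; have lt := parent_lt v0 vlt.
apply: IH.
- by rewrite (leq_trans lt).
- by apply: parent_mono; [rewrite leq_div2r // -ltnS !prednK | rewrite ltn_divLR // -ltnS prednK].
- exact: ltn_trans vlt.
Qed.

Lemma canonical_rooted :
  rooted (G := canonical) (ord0 : V) top_vertex up_edge (fun v => depth (v : V)).
Proof.
have inE j (v : V) : j < m -> v \in canonical_edge j ->
    (top_vertex (canonical_edge j) : canonical) != v -> 0 < v /\ v.-1 %/ n = j.
  move=> jm; rewrite mem_canonical_edge // -(top_canonical_edge jm).
  case/orP=> [/eqP vE|/andP[v0 /eqP <-]//].
  by case/eqP; apply/val_inj.
split.
- move=> e /canonical_edgeP[j jm ->].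
  by rewrite mem_canonical_edge // (top_canonical_edge jm) eqxx.
- move=> v vv0; have v0 : 0 < (v : V).
    by rewrite lt0n; apply: contra vv0 => /eqP E; apply/eqP/val_inj.
  have jm := edge_of_child v0; split.
  + exact: canonical_edge_in.
  + by rewrite mem_canonical_edge // v0 eqxx orbT.
  + apply/eqP => /(congr1 val) /=; rewrite /up_edge (top_canonical_edge jm) => E.
    by have := parent_lt v0 (ltn_ord (v : V)); rewrite E ltnn.
- move=> e /canonical_edgeP[j jm ->] v ve /(inE j v jm ve)[v0 vj].
  by split; [rewrite -val_eqE /= -lt0n | rewrite /up_edge vj].
- by [].
- move=> v vv0; have v0 : 0 < (v : V).
    by rewrite lt0n; apply: contra vv0 => /eqP E; apply/eqP/val_inj.
  by rewrite (top_canonical_edge (edge_of_child v0)) depthE.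
Qed.

Lemma canonical_uniform : uniform n.+1 canonical.
Proof.
move=> e /canonical_edgeP[j jm ->]; rewrite cardsU1 card_imset ?card_ord.
  case: imsetP => [[r _ /(congr1 val)]|//] /=.
  rewrite !inordK ?child_lt ?parent_lt_size // => E.
  by have := parent_le jm; rewrite E ltnNge leq_addr.
move=> r r' /(congr1 val); rewrite /= !inordK ?child_lt // => -[/addnI rr'].
exact: val_inj.
Qed.

Lemma canonical_degree (v : V) : degree (G := canonical) v = nth 0 pi v.
Proof.
have := count_parents canonical_rooted (perm_refl _) (pred1 (v : canonical)).
rewrite big_pred1_eq => <-.
have -> : count (pred1 (v : canonical) \o top_vertex) (enum (edges canonical)) = child_count v.
  rewrite -sum1_count big_enum_cond big_mkcondr /= big_imset /=; last first.
    by move=> i j _ _ /canonical_edge_inj E; apply/val_inj/E.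
  rewrite -count_parents_mem ?pi_size // -sum1_count [RHS](big_nth 0) size_parents.
  rewrite big_mkord [RHS]big_mkcond /=; apply: eq_bigr => j _.
  by rewrite -(top_canonical_edge (ltn_ord j)).
have -> : #|[pred u : canonical | pred1 (v : canonical) u & u != (ord0 : V)]| = (v != 0 :> nat).
  have [v0|v0] := eqVneq (v : nat) 0.
    apply: eq_card0 => u; rewrite !inE; apply/negP => /andP[/eqP->].
    by rewrite -val_eqE /= v0.
  apply: (@eq_card1 _ (v : canonical)) => u; rewrite !inE.
  by case: eqP => [->|//]; rewrite -val_eqE.
rewrite /child_count subnK //; have [//|v0] := eqVneq (v : nat) 0.
have m0 : 0 < m by apply: leq_ltn_trans (leq0n _) (edge_of_child (v := v) _); rewrite lt0n.
by apply: (allP (pi_pos m0)); rewrite mem_nth // pi_size.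
Qed.

Lemma canonical_supertree : supertree n.+1 canonical.
Proof.
split; first exact: canonical_uniform.
- exact: rooted_connected canonical_rooted.
- exact: rooted_acyclic canonical_rooted.
Qed.

Lemma canonical_degree_sequence : has_degree_sequence pi canonical.
Proof.
rewrite /has_degree_sequence (eq_map canonical_degree).
rewrite (map_comp (nth 0 pi) (fun v : V => v : nat)) val_enum_ord -pi_size.
by rewrite -/(mkseq _ _) mkseq_nth.
Qed.

Lemma ord_well_order p : well_order (fun u v : 'I_p => u <= v).
Proof.
move=> A [x xA]; have [z zA zmin] := @arg_minnP _ x (mem A) (fun v => v : nat) xA.
exists z; split=> [|w [wA wmin]]; first by split.
by apply/val_inj/eqP; rewrite eqn_leq wmin // zmin.
Qed.

Lemma canonical_step j (u u' : V) : j < m ->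
  u \in canonical_edge j -> u' \in canonical_edge j -> depth u = (depth u').+1 ->
  [/\ 0 < u, u.-1 %/ n = j & u' = nth 0 parents j :> nat].
Proof.
move=> jm ue u'e E; have rc := canonical_rooted.
have eG := canonical_edge_in jm.
have [qu|qu] := eqVneq (top_vertex (canonical_edge j)) u.
  have [qu'|qu'] := eqVneq (top_vertex (canonical_edge j)) u'.
    by move: E; rewrite -qu -qu'; lia.
  by have := rooted_child rc eG u'e qu'; rewrite qu E; lia.
have hu := rooted_child rc eG ue qu.
have [qu'|qu'] := eqVneq (top_vertex (canonical_edge j)) u'; last first.
  by have := rooted_child rc eG u'e qu'; rewrite -hu E; lia.
rewrite -qu' (top_canonical_edge jm); move: ue; rewrite mem_canonical_edge //.
rewrite -(top_canonical_edge jm) => /orP[/eqP uE|/andP[u0 /eqP uj]]; last by split.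
by case/eqP: qu; apply/val_inj.
Qed.

(** The children of the edge [j] are the [v > 0] with [v.-1 %/ n = j], an interval, which gives
    (iv); sortedness of [parents] gives (i) and (iii), that of [pi] gives (ii). *)
Lemma canonical_BFS : BFS_ordering (G := canonical) (ord0 : V)
  (fun u v => (u : V) <= (v : V)).
Proof.
have dist v : distance (G := canonical) (ord0 : V) v = depth (v : V).
  exact: (rooted_distance canonical_rooted).
split; first exact: ord_well_order.
split.
- by move=> u v uv; rewrite !dist depth_mono // ltn_ord.
- by move=> u v uv; rewrite !canonical_degree pi_anti.
- move=> e f u u' v v' /canonical_edgeP[i im ->] /canonical_edgeP[j jm ->] ue u'e vf v'f.
  rewrite !dist => hu hv uv.
  have [u0 ui ->] := canonical_step im ue u'e hu.
  have [v0 vj ->] := canonical_step jm vf v'f hv.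
  by apply: parent_mono; rewrite // -ui -vj leq_div2r // -ltnS !prednK.
- move=> e /canonical_edgeP[j jm ->] s i u i1 ie ue [siu usi].
  have rt : total (fun u v : canonical => (u : V) <= (v : V)) by move=> x y; exact: leq_total.
  have rtr : transitive (fun u v : canonical => (u : V) <= (v : V)).
    by move=> y x z; exact: leq_trans.
  have rr : reflexive (fun u v : canonical => (u : V) <= (v : V)) by move=> x; exact: leqnn.
  have ss : sorted (fun u v : canonical => (u : V) <= (v : V)) s by exact: sort_sorted.
  have us : uniq s by rewrite sort_uniq enum_uniq.
  have sz : size s = #|canonical_edge j| by rewrite size_sort -cardE.
  have ms v : (v \in s) = (v \in canonical_edge j) by rewrite mem_sort mem_enum.
  have child t : 0 < t -> t < size s -> 0 < (nth u s t : V) /\ (nth u s t : V).-1 %/ n = j.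
    move=> t0 ts; have : nth u s t \in canonical_edge j by rewrite -ms mem_nth.
    rewrite mem_canonical_edge // => /orP[/eqP tE|/andP[-> /eqP->]//].
    have s0 : 0 < size s by exact: leq_ltn_trans ts.
    have := sorted_leq_nth rtr rr u ss 0 t s0 ts (ltnW t0); rewrite tE.
    have : nth u s 0 \in canonical_edge j by rewrite -ms mem_nth.
    rewrite mem_canonical_edge // => /orP[/eqP E0|/andP[p0 /eqP pj] le0].
      have /eqP : nth u s 0 = nth u s t by apply/val_inj; rewrite /= E0 tE.
      by rewrite nth_uniq // eq_sym (gtn_eqF t0).
    have := leq_trans le0 (parent_le jm).
    have := leq_trunc_div (nth u s 0 : V).-1 n; rewrite pj.
    move: p0; set z := nat_of_ord _; lia.
  have [a0 aj] := child i i1 (etrans (congr1 (leq _) sz) (ltnW ie)).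
  have [b0 bj] := child i.+1 isT (etrans (congr1 (leq _) sz) ie).
  have u0 := leq_trans a0 siu.
  case/negP: ue; rewrite mem_canonical_edge // u0; apply/orP; right.
  rewrite /= eqn_leq; apply/andP; split; [rewrite -[X in _ <= X]bj | rewrite -[X in X <= _]aj];
    by rewrite leq_div2r // -ltnS !prednK.
Qed.

End Canonical.

(** * Order and degrees of a supertree *)

Section Numerics.
Variables (k : nat) (G : hypergraph).
Hypotheses (k2 : (2 <= k)%N) (sG : supertree k G).

Lemma supertree_card : #|G| = (#|edges G| * k.-1).+1.
Proof.
have [unif [/card_gt0P[v0 _] _] _] := sG.
have [q [a [h rG]]] := supertree_rooted v0 k2 sG.
have := sum_children rG (fun=> 1%N).
rewrite sum1_card => E; have : #|[pred v | v != v0]| = (#|edges G| * k.-1)%N.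
  rewrite E -sum_nat_const; apply: eq_bigr => e eG; rewrite sum1_card.
  by have := cardsD1 (q e) e; case: rG => q1 _ _ _ _; rewrite q1 // unif // => ->.
by move <-; rewrite (cardD1 v0) inE add1n; congr _.+1; apply: eq_card => v; rewrite !inE andbT.
Qed.

Lemma supertree_degree_sum : (\sum_v @degree G v = #|edges G| * k)%N.
Proof.
have [unif _ _] := sG.
transitivity (\sum_(v : vertex G) \sum_(e in edges G | v \in e) 1)%N.
  by apply: eq_bigr => v _; rewrite sum1_card.
rewrite (exchange_big_dep (mem (edges G))) /=; last by move=> v e _ /andP[].
rewrite -sum_nat_const; apply: eq_bigr => e eG; rewrite (eq_bigl (mem e)) => [|v].
  by rewrite sum1_card unif.
by rewrite eG.
Qed.

(** Rooting the tree at another vertex gives [v] an edge above it. *)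
Lemma supertree_degree_gt0 (v : G) : (0 < #|edges G|)%N -> (0 < degree v)%N.
Proof.
move=> m0; have : (1 < #|G|)%N.
  by rewrite supertree_card ltnS muln_gt0 m0 -ltnS prednK ?(ltnW k2).
case/card_gt1P=> u [w [_ _ uw]].
have [z zv] : exists z, v != z.
  have [E|] := eqVneq v u; last by exists u.
  by exists w; rewrite E.
have [q [a [h [_ a1 _ _ _]]]] := supertree_rooted z k2 sG.
by have [aG va _] := a1 v zv; apply/card_gt0P; exists (a v); rewrite inE aG.
Qed.

Lemma bfs_supertree_exists pi : sorted geq pi -> has_degree_sequence pi G ->
  exists G', in_TT k pi G' /\ BFS_supertree k G'.
Proof.
move=> pi_sorted dG; have k1 : k = k.-1.+1 by rewrite prednK ?(ltnW k2).
have n0 : (0 < k.-1)%N by rewrite -ltnS -k1.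
have pi_size : size pi = (#|edges G| * k.-1).+1.
  by rewrite -supertree_card -(perm_size dG) size_map -cardE.
have pi_sum : sumn pi = (#|edges G| * k.-1 + #|edges G|)%N.
  rewrite -(perm_sumn dG) sumnE big_map big_enum -mulnSr -k1.
  exact: supertree_degree_sum.
have pi_pos : (0 < #|edges G|)%N -> all (leq 1) pi.
  move=> m0; rewrite -(perm_all _ dG); apply/allP => _ /mapP[v _ ->].
  exact: supertree_degree_gt0.
have sC := canonical_supertree n0 pi_sorted pi_size pi_sum pi_pos.
rewrite -k1 in sC.
exists (canonical k.-1 #|edges G| pi); split; split=> //.
  exact: canonical_degree_sequence.
exists ord0, (fun u v : canonical k.-1 #|edges G| pi => (nat_of_ord u <= nat_of_ord v)%N).
exact: canonical_BFS.
Qed.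

End Numerics.

Section BlockTypes.
Variables (R : realType) (G : hypergraph) (x : G -> R).
Variables (v0 : G) (q : {set G} -> G) (a : G -> {set G}) (h : G -> nat).
Hypothesis rG : rooted v0 q a h.
Variables (es : seq {set G}) (ch : {set G} -> seq G).
Hypothesis es_perm : perm_eq es (enum (edges G)).
Hypothesis ch_perm : {in edges G, forall e, perm_eq (ch e) (enum (e :\ q e))}.

(** The type of an edge is its normalised block with the distinction of the top weight forgotten, so
    equal multisets of blocks yield equal multisets of types. *)
Lemma edge_type_blocks :
  map (edge_type x) es =
  map (fun b => sort >=%R (b.1 :: b.2)) (map (@norm_block R) (blocks q es ch x)).
Proof.
rewrite -!map_comp; apply/eq_in_map => e; rewrite (perm_mem es_perm) mem_enum => eG /=.
have qe : q e \in e by case: rG => q1 _ _ _ _; exact: q1.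
rewrite -(edge_type_eq (x := x) (e := e)) //.
rewrite perm_sym (perm_trans (y := x (q e) :: map x (ch e))) ?perm_cons ?perm_sort //.
rewrite -map_cons; apply: perm_map.
rewrite (perm_trans (y := q e :: enum (e :\ q e))) ?perm_cons ?ch_perm //.
apply: uniq_perm; rewrite ?enum_uniq //= ?enum_uniq ?mem_enum ?setD11 //.
by move=> v; rewrite inE !mem_enum !inE; case: eqVneq => [->|].
Qed.

Lemma card_edge_type t :
  #|[set e in edges G | edge_type x e == t]| = count_mem t (map (edge_type x) es).
Proof.
rewrite count_map (permP es_perm) -sum1_count big_enum_cond /= -sum1dep_card.
by [].
Qed.

End BlockTypes.

(** * Extremality and the equality case *)

Section Extremal.
Variables (R : realType) (k : nat) (alpha : R).
Hypotheses (k2 : (2 <= k)%N) (alpha01 : 0 <= alpha < 1).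
Variables G H : hypergraph.
Hypotheses (sG : supertree k G) (bG : BFS_supertree k G) (sH : supertree k H).
Hypothesis same_degrees :
  perm_eq [seq degree v | v <- enum G] [seq degree v | v <- enum H].

Lemma bfs_extremal :
  alpha_spectral_radius k alpha H <= alpha_spectral_radius k alpha G /\
  (alpha_spectral_radius k alpha H = alpha_spectral_radius k alpha G ->
   isomorphic H G).
Proof.
have [unifG connG acyG] := sG; have [unifH connH acyH] := sH.
have [_ [v0 [le bfs]]] := bG.
have [rho [x px]] := perron_exists k2 alpha01 unifH connH.
have [rhoG [z pz]] := perron_exists k2 alpha01 unifG connG.
rewrite (perron_spectral_radius k2 alpha01 unifH connH px).
rewrite (perron_spectral_radius k2 alpha01 unifG connG pz).
have [x_gt0 x_eig _] := px; have [_ _ dom] := pz.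
have [/card_gt0P[w _] _] := connH.
have [w0 _ x_max] := @arg_maxP _ _ _ w xpredT x isT.
have [q [a [h rG]]] := supertree_rooted v0 k2 sG.
have [p [b [g rH]]] := supertree_rooted w0 k2 sH.
pose y := transport le x.
have y_gt0 v : 0 < y v by exact: (transport_gt0 v0 le x_gt0 same_degrees).
have y_anti u v : le u v -> y v <= y u by exact: (transport_anti bfs x same_degrees).
have [le1 eq1] := form_transport k2 alpha01 unifG bfs rG unifH rH x_gt0
  (fun v => x_max v isT) same_degrees.
have formx := perron_form unifH px.
have nxy : knorm k y = knorm k x.
  exact: (transport_big v0 le x same_degrees (fun r => r ^+ k)).
have n0 : 0 < knorm k x.
  rewrite /knorm (bigD1 w) //= ltr_pwDl ?exprn_gt0 ?sumr_ge0 // => v _.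
  by rewrite exprn_ge0 // ltW.
have le2 := dom y (fun v => ltW (y_gt0 v)).
split.
  by rewrite -(ler_pM2r n0) -formx -[in leRHS]nxy (le_trans le1).
move=> rhoE; rewrite -rhoE in dom le2.
(* Equal radii make the transported weights a maximizer for [G], hence an eigenvector by
   [maximizer_perron]. *)
have fy : form k alpha y = rho * knorm k y.
  by apply/le_anti; rewrite le2 nxy -formx.
have blocksE := eq1 (etrans formx (etrans (congr1 _ (esym nxy)) (esym fy))).
have [_ y_eig _] := maximizer_perron k2 y_gt0 fy dom.
set bH := blocks p _ _ x in blocksE; set bG' := blocks q _ _ y in blocksE.
have pes : perm_eq (bfs_edges v0 le q) (enum (edges G)) by rewrite perm_sort.
have phs : perm_eq (sort (relpre (x \o p) >=%R) (enum (edges H))) (enum (edges H)).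
  by rewrite perm_sort.
have pch : {in edges G, forall e, perm_eq (children le q e) (enum (e :\ q e))}.
  by move=> e _; rewrite perm_sort.
have phch : {in edges H, forall e, perm_eq ((fun e => enum (e :\ p e)) e) (enum (e :\ p e))}.
  by [].
have same_types t : #|[set e in edges H | edge_type x e == t]| =
    #|[set e in edges G | edge_type y e == t]|.
  rewrite (card_edge_type x phs) (card_edge_type y pes).
  rewrite (edge_type_blocks x rH phs phch) (edge_type_blocks y rG pes pch).
  by apply/permP/perm_map.
have same_classes c : #|[pred v | x v == c]| = #|[pred v | y v == c]|.
  have E : (\sum_v (y v == c) = \sum_v (x v == c))%N.
    exact: (transport_big v0 le x same_degrees (fun r => (r == c) : nat)).
  have cardE' (K : hypergraph) (f : K -> R) : #|[pred v | f v == c]| = (\sum_v (f v == c))%N.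
    rewrite -sum1_card big_mkcond; apply: eq_bigr => v _.
    by rewrite inE; case: (f v == c).
  by rewrite !cardE' E.
(* In [G] the BFS-ordering makes the top the heaviest vertex of its edge; [H] inherits this through
   the equality of the multisets of blocks. *)
have parent_top : all (fun b => all (fun r : R => r <= b.1) b.2) (map (@norm_block R) bH).
  rewrite (perm_all _ blocksE) !all_map; apply/allP => e.
  rewrite mem_bfs_edges => eG /=; rewrite all_sort all_map.
  apply/allP => v; rewrite mem_childrenE => /setD1P[_ ve].
  exact/y_anti/(bfs_parent_le bfs rG).
have x_parent : {in edges H, forall e : {set H}, {in e, forall v, x v <= x (p e)}}.
  move=> e eH v ve; have [->//|vp] := eqVneq v (p e).
  move: parent_top; rewrite !all_map => /allP/(_ e).
  rewrite (perm_mem phs) mem_enum => /(_ eH) /=; rewrite all_sort all_map.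
  by move/allP/(_ v); apply; rewrite mem_enum !inE vp.
have counts v v' t : x v = y v' -> type_count x v t = type_count y v' t.
  exact: (local_count k2 alpha01 unifG bfs rG y_gt0 y_anti y_eig rH x_eig x_parent
    same_types same_classes).
apply: (isomorphic_of_counts k2 sG sH counts (v0 := w0) (v0' := v0)).
  exact/esym/(transport_root bfs rG (fun v => x_max v isT) same_degrees).
by have := perm_size same_degrees; rewrite !size_map !cardT !enumT.
Qed.

End Extremal.

Theorem theorem4p6 (R : realType) (k : nat) (alpha : R) (pi : seq nat)
    (hk : (2 <= k)%N)
    (halpha : 0 <= alpha < 1)
    (pi_sorted : sorted geq pi)
    (pi_supertree : exists G : hypergraph, in_TT k pi G) :
  (exists G : hypergraph, in_TT k pi G /\ BFS_supertree k G) /\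
  forall G : hypergraph, in_TT k pi G -> BFS_supertree k G ->
  forall H : hypergraph, in_TT k pi H ->
    alpha_spectral_radius k alpha H <= alpha_spectral_radius k alpha G /\
    (alpha_spectral_radius k alpha H = alpha_spectral_radius k alpha G ->
     isomorphic H G).
Proof.
have [G0 [sG0 dG0]] := pi_supertree.
split; first exact: bfs_supertree_exists hk sG0 _ pi_sorted dG0.
move=> G [sG dG] bG H [sH dH]; apply: bfs_extremal => //.
by rewrite (permPl dG) perm_sym.
Qed.
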